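(* Let $X$ be a real Banach space which is an $L_1$-predual. Then the following are equivalent. (a) $X$ is Hahn-Banach smooth. (b) There exist a discrete set $\Gamma$ and an isometric isomorphism $T:X^*\to \ell_1(\Gamma)$ such that the restriction $T_1=T|_{S_{X^*}}$ is a homeomorphism from $(S_{X^*},w^*(X))$ onto $(S_{\ell_1(\Gamma)},w^*(c_0(\Gamma)))$. (c) There exist a discrete set $\Gamma$ and an isometric isomorphism $T:X^*\to \ell_1(\Gamma)$ such that the restriction $T_1=T|_{S_{X^*}}$ is a homeomorphism from $(S_{X^*},w^*(X))$ onto $(S_{\ell_1(\Gamma)},w)$.
   Context: All Banach spaces are over the reals. $S_Z$ denotes the unit sphere of a Banach space $Z$. $w$ is the weak topology. $w^*(X)$ is the weak-$*$ topology on $X^*$ induced by $X$, and $w^*(c_0(\Gamma))$ is the weak-$*$ topology on $\ell_1(\Gamma)=c_0(\Gamma)^*$ induced by $c_0(\Gamma)$, where $c_0(\Gamma)$ consists of all $\varphi:\Gamma\to\mathbb{R}$ such that $\{\gamma:|\varphi(\gamma)|>\varepsilon\}$ is finite for every $\varepsilon>0$, with the sup norm. Spheres carry the relative topologies. An isometric isomorphism is a linear surjective isometry. A Banach space $X$ is an $L_1$-predual if $X^*$ is isometrically isomorphic to $L_1(\mu)$ for some measure space $(\Omega,\Sigma,\mu)$. $X$ is Hahn-Banach smooth if every $x^*\in X^*$ has a unique norm-preserving linear extension from $X$ (canonically embedded in $X^{**}$) to $X^{**}$. *)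

(* Defs.v *)
From HB Require Import structures.
From mathcomp Require Import all_boot all_order all_algebra.
From mathcomp Require Import all_classical all_reals all_analysis.
From mathcomp Require Import measurable_realfun.

Set Implicit Arguments.
Unset Strict Implicit.
Unset Printing Implicit Defensive.

Import Order.TTheory GRing.Theory Num.Theory.
Import numFieldNormedType.Exports.

Local Open Scope classical_set_scope.
Local Open Scope ring_scope.

Definition unit_sphere {R : realType} {V : normedModType R} : set V :=
  [set x | `|x| = 1].
Arguments unit_sphere {R} V.

Definition isometric_isomorphism {R : realType} {U V : normedModType R}
    (T : {linear U -> V}) : Prop :=
  (forall x, `|T x| = `|x|) /\ set_surj [set: U] [set: V] T.

Definition homeomorphism_on (U V : topologicalType) (A : set U) (B : set V)
    (f : U -> V) : Prop :=
  [/\ set_bij A B f, {within A, continuous f} &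
      exists2 g : V -> U, {in A, cancel f g} & {within B, continuous g}].
Arguments homeomorphism_on : clear implicits.

(* The coarsest topology on [V] making all the maps [B ^~ i] continuous. *)
Definition pairing_topology {R : realType} {V : choiceType} {I : Type}
    (B : V -> I -> R) : Type :=
  initial_topology (B : V -> prod_topology (fun _ : I => R)).

HB.instance Definition _ (R : realType) (V : choiceType) (I : Type)
    (B : V -> I -> R) :=
  Topological.copy (pairing_topology B)
    (initial_topology (B : V -> prod_topology (fun _ : I => R))).

Section dual.
Context {R : realType} (V : normedModType R).

Definition is_dual : {pred V -> R^o} :=
  mem [set f : V -> R^o | linear f /\ continuous f].

Lemma is_dualP (f : V -> R^o) :
  reflect (linear f /\ continuous f) (f \in is_dual).
Proof. by apply: (iffP idP); rewrite inE. Qed.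

Lemma is_dual_submod_closed : submod_closed is_dual.
Proof.
split.
  apply/is_dualP; split; last by move=> x; exact: cvg_cst.
  by move=> a x y; rewrite [LHS]/(0 : R^o) scaler0 addr0.
move=> a f g /is_dualP[lf cf] /is_dualP[lg cg]; apply/is_dualP; split.
  move=> b x y; rewrite -[LHS]/(a *: f (b *: x + y) + g (b *: x + y)) lf lg.
  by rewrite !scalerDr addrACA !scalerA (mulrC a).
by move=> x; apply: cvgD; [apply: cvgZr; exact: cf|exact: cg].
Qed.

HB.instance Definition _ :=
  GRing.isSubmodClosed.Build _ _ is_dual is_dual_submod_closed.

Record dual := Dual { dual_fun :> V -> R^o ; _ : dual_fun \in is_dual }.

HB.instance Definition _ := [isSub for dual_fun].
HB.instance Definition _ := [Choice of dual by <:].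
HB.instance Definition _ := [SubChoice_isSubLmodule of dual by <:].

Lemma dual_linear (f : dual) : linear f.
Proof. by case: f => f /= /is_dualP[]. Qed.

HB.instance Definition _ (f : dual) :=
  GRing.isLinear.Build R V R^o *:%R f (@dual_linear f).

Lemma dual_continuous (f : dual) : continuous f.
Proof. by case: f => f /= /is_dualP[]. Qed.

Lemma dualP (f g : dual) : f =1 g -> f = g.
Proof. by move=> fg; apply/val_inj/funext. Qed.

Definition dual_norm (f : dual) : R :=
  sup [set `|f x| | x in [set x : V | `|x| <= 1]].

Lemma dual_norm_has_sup (f : dual) :
  has_sup [set `|f x| | x in [set x : V | `|x| <= 1]].
Proof.
split; first by exists `|f 0|, 0 => //=; rewrite normr0.
have /(linear_bounded_continuous f)/bounded_funP/(_ 1)[M fM] :=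
  @dual_continuous f.
by exists M => _ [x /= x1 <-]; exact: fM.
Qed.

Lemma dual_norm_le (f : dual) (M : R) :
  (forall x, `|x| <= 1 -> `|f x| <= M) -> dual_norm f <= M.
Proof.
move=> fM; apply: ge_sup; first by case: (dual_norm_has_sup f).
by move=> _ [x /= x1 <-]; exact: fM.
Qed.

Lemma le_dual_norm (f : dual) x : `|x| <= 1 -> `|f x| <= dual_norm f.
Proof.
move=> x1; apply: ub_le_sup; first by case: (dual_norm_has_sup f).
by exists x.
Qed.

Lemma dual_norm_ge0 (f : dual) : 0 <= dual_norm f.
Proof. by apply: le_trans (le_dual_norm f (x := 0) _); rewrite ?normr0. Qed.

Lemma dual_norm_bound (f : dual) x : `|f x| <= dual_norm f * `|x|.
Proof.
have [->|x0] := eqVneq x 0; first by rewrite linear0 !normr0 mulr0.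
rewrite -ler_pdivrMr ?normr_gt0//.
have -> : `|f x| / `|x| = `|f (`|x|^-1 *: x)|.
  by rewrite linearZ normrZ normfV normr_id mulrC.
by apply: le_dual_norm; rewrite normrZ normfV normr_id mulVf ?normr_eq0.
Qed.

Lemma dual_normD f g : dual_norm (f + g) <= dual_norm f + dual_norm g.
Proof.
apply: dual_norm_le => x x1.
by rewrite (le_trans (ler_normD _ _))// lerD ?le_dual_norm.
Qed.

Lemma dual_normZ (l : R) f : dual_norm (l *: f) = `|l| * dual_norm f.
Proof.
have le_l k g : dual_norm (k *: g) <= `|k| * dual_norm g.
  apply: dual_norm_le => x x1.
  by rewrite [X in `|X|]/(k *: g x) normrZ ler_wpM2l ?le_dual_norm.
apply/eqP; rewrite eq_le le_l/=.
have [->|l0] := eqVneq l 0; first by rewrite normr0 mul0r dual_norm_ge0.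
rewrite -ler_pdivlMl ?normr_gt0// -normfV.
by rewrite (le_trans _ (le_l _ _))// scalerA mulVf// scale1r.
Qed.

Lemma dual_norm_eq0 f : dual_norm f = 0 -> f = 0.
Proof.
move=> f0; apply: dualP => x; apply/eqP; rewrite -normr_le0.
by rewrite (le_trans (dual_norm_bound f x))// f0 mul0r.
Qed.

HB.instance Definition _ := Lmodule_isNormed.Build R dual
  dual_normD dual_normZ dual_norm_eq0.

Lemma dual_normE (f : dual) : `|f| = dual_norm f. Proof. by []. Qed.

Definition weak_star : Type := pairing_topology (fun (f : dual) (x : V) => f x).
HB.instance Definition _ := Topological.on weak_star.

Definition weak : Type := pairing_topology (fun (x : V) (f : dual) => f x).
HB.instance Definition _ := Topological.on weak.

End dual.
Arguments is_dual {R V}.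

Section canonical_embedding.
Context {R : realType} {V : normedModType R}.

Lemma evaluation_is_dual (x : V) :
  (fun f : dual V => f x : R^o) \in is_dual.
Proof.
have lx : linear (fun f : dual V => f x : R^o) by [].
apply/is_dualP; split => //.
pose L := GRing.isLinear.Build R (dual V) R^o *:%R _ lx.
pose ev : {linear dual V -> R^o} := HB.pack (fun f : dual V => f x : R^o) L.
apply: (@bounded_linear_continuous _ _ _ ev); apply/linear_boundedP.
near=> r => f; rewrite (le_trans (dual_norm_bound f x))// mulrC ler_wpM2r//.
exact: dual_norm_ge0.
Unshelve. all: by end_near. Qed.

Definition canonical_embedding (x : V) : dual (dual V) :=
  Dual (evaluation_is_dual x).

End canonical_embedding.

Definition hahn_banach_smooth {R : realType} (X : normedModType R) : Prop :=
  forall f : dual X, exists! F : dual (dual (dual X)),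
    (forall x : X, F (canonical_embedding x) = f x) /\ `|F| = `|f|.

Section ell1.
Context {R : realType} (Gamma : choiceType).

Definition is_ell1 : {pred Gamma -> R^o} :=
  mem [set f : Gamma -> R^o | summable [set: Gamma] (EFin \o f)].

Lemma is_ell1P (f : Gamma -> R^o) :
  reflect (summable [set: Gamma] (EFin \o f)) (f \in is_ell1).
Proof. by apply: (iffP idP); rewrite inE. Qed.

Lemma esum_normZ (a : R) (f : Gamma -> R^o) :
  (\esum_(g in [set: Gamma]) `|(EFin \o (a *: f)) g| =
   `|a|%:E * \esum_(g in [set: Gamma]) `|(EFin \o f) g|)%E.
Proof.
rewrite /esum -ereal_supZl ?normr_ge0//; last first.
  by apply/set0P; exists 0%E, set0 => //=; rewrite fsbig_set0.
rewrite image_comp; congr ereal_sup; apply: eq_imagel => A _ /=.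
rewrite ge0_mule_fsumr//; apply: eq_fsbigr => g _.
by rewrite -EFinM; congr EFin; exact: normrZ.
Qed.

Lemma is_ell1_submod_closed : submod_closed is_ell1.
Proof.
split.
  apply/is_ell1P; rewrite /summable esum1 ?ltry// => g _ /=.
  by rewrite normr0.
move=> a f h /is_ell1P sf /is_ell1P sh; apply/is_ell1P.
apply: (@summableD _ _ _ (EFin \o (a *: f)) (EFin \o h)) => //.
by rewrite /summable esum_normZ lte_mul_pinfty// ?lee_fin//.
Qed.

HB.instance Definition _ :=
  GRing.isSubmodClosed.Build _ _ is_ell1 is_ell1_submod_closed.

Record ell1 := Ell1 { ell1_fun :> Gamma -> R^o ; _ : ell1_fun \in is_ell1 }.

HB.instance Definition _ := [isSub for ell1_fun].
HB.instance Definition _ := [Choice of ell1 by <:].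
HB.instance Definition _ := [SubChoice_isSubLmodule of ell1 by <:].

Lemma ell1_summable (f : ell1) : summable [set: Gamma] (EFin \o f).
Proof. by case: f => f /= /is_ell1P. Qed.

Lemma ell1P (f h : ell1) : f =1 h -> f = h.
Proof. by move=> fh; apply/val_inj/funext. Qed.

Definition ell1_norm (f : ell1) : R :=
  fine (\esum_(g in [set: Gamma]) `|(EFin \o f) g|)%E.

Lemma ell1_normK (f : ell1) :
  ((ell1_norm f)%:E = \esum_(g in [set: Gamma]) `|(EFin \o f) g|)%E.
Proof. by rewrite fineK// -summableE; exact: ell1_summable. Qed.

Lemma ell1_normD f h : ell1_norm (f + h) <= ell1_norm f + ell1_norm h.
Proof.
rewrite -lee_fin EFinD !ell1_normK -esumD//.
by apply: le_esum => g _; exact: (lee_abs_add (f g)%:E (h g)%:E).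
Qed.

Lemma ell1_normZ (l : R) f : ell1_norm (l *: f) = `|l| * ell1_norm f.
Proof. by apply: EFin_inj; rewrite EFinM !ell1_normK esum_normZ. Qed.

Lemma ell1_norm_ge (f : ell1) g : `|f g| <= ell1_norm f.
Proof.
rewrite -lee_fin ell1_normK; apply: esum_ge; exists [set g].
  by split; [exact: finite_set1|].
by rewrite fsbig_set1.
Qed.

Lemma ell1_norm_eq0 f : ell1_norm f = 0 -> f = 0.
Proof.
move=> f0; apply: ell1P => g; apply/eqP.
by rewrite -normr_le0 -f0; exact: ell1_norm_ge.
Qed.

HB.instance Definition _ := Lmodule_isNormed.Build R ell1
  ell1_normD ell1_normZ ell1_norm_eq0.

Definition c0 : set (Gamma -> R) :=
  [set phi | forall e : R, 0 < e -> finite_set [set g | e < `|phi g|]].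

Lemma c0_bounded (phi : Gamma -> R) : c0 phi ->
  exists M, forall g, `|phi g| <= M.
Proof.
move=> /(_ 1 ltr01) fin1.
have /finite_seqP[s sE] := fin1.
exists (1 + \sum_(g <- s) `|phi g|) => g.
have [gs|] := boolP (g \in s).
  rewrite (big_rem g)//= addrCA lerDl addr_ge0// sumr_ge0//.
move=> gs; have : ~ [set g | 1 < `|phi g|] g by rewrite sE /= (negbTE gs).
move=> /negP; rewrite -leNgt => /le_trans; apply.
by rewrite lerDl sumr_ge0.
Qed.

(* The sum over [g] of [phi g * f g], which converges absolutely by
   [ell1_c0_summable] below; [esum] only makes sense for nonnegative terms,
   hence the splitting. *)
Definition ell1_c0_pairing (f : ell1) (phi : c0) : R :=
  let p : Gamma -> R := fun g => set_val phi g * f g in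
  fine (\esum_(g in [set: Gamma]) (p^\+ g)%:E)%E -
  fine (\esum_(g in [set: Gamma]) (p^\- g)%:E)%E.

Lemma ell1_c0_summable (f : ell1) (phi : c0) :
  summable [set: Gamma] (fun g => (set_val phi g * f g)%:E).
Proof.
have [M phiM] := c0_bounded (set_valP phi).
have M0 : 0 <= `|M| by [].
have : summable [set: Gamma] (EFin \o (M *: f)) by exact: ell1_summable.
apply: le_lt_trans; apply: le_esum => g _ /=.
rewrite lee_fin normrM [X in _ <= `|X|]/(M * f g) normrM.
by rewrite ler_wpM2r// (le_trans (phiM g))// ler_norm.
Qed.

(* This is the weak-star topology of the dual of [c0], transported along the
   identification of that dual with [ell1]. The norm of [c0] plays no role. *)
Definition ell1_weak_star : Type := pairing_topology ell1_c0_pairing.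
HB.instance Definition _ := Topological.on ell1_weak_star.

End ell1.
Arguments ell1 R Gamma : clear implicits.
Arguments c0 R Gamma : clear implicits.
Arguments ell1_weak_star R Gamma : clear implicits.

Section L1.
Context {d} {T : measurableType d} {R : realType}.
Variable mu : {measure set T -> \bar R}.
Local Notation Lf := (LfunType mu (@lexx _ _ 1%E)).
Local Notation mfunB := {mfun T >-> measurableTypeR R}.
Local Notation aeB := {mfun_ mu, T >-> measurableTypeR R}.

(* [LspaceType1 mu] consists of a.e.-classes of measurable functions with a
   finite 1-norm, but carries no algebraic structure. *)
Definition L1 : Type := LspaceType1 mu.
HB.instance Definition _ := gen_eqMixin L1.
HB.instance Definition _ := gen_choiceMixin L1.

Definition L1_fun (u : L1) : T -> R := repr (LebesgueSpace.sort u).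

Lemma L1_fun_Lfun (u : L1) : L1_fun u \in Lfun mu 1.
Proof.
rewrite inE; apply/andP; split; apply/mem_set.
  exact: (@measurable_funPT _ _ _ _ (repr (LebesgueSpace.sort u))).
exact: (@Lebesgue_finite _ _ _ _ _ _ u).
Qed.

Definition L1_repr (u : L1) : Lf := Lfun_Sub (lexx 1%E) (L1_fun_Lfun u).

Lemma Lfun_measurable (f : Lf) : measurable_fun setT f.
Proof. by []. Qed.

Definition Lfun_borel (f : Lf) : mfunB :=
  HB.pack (f : T -> R)
    (@isMeasurableFun.Build _ _ T (measurableTypeR R) f (Lfun_measurable f)).

Definition ae_class (f : Lf) : aeB := (\pi_aeB (Lfun_borel f))%qT.

Lemma ae_class_repr (f : Lf) :
  {ae mu, forall x, repr (ae_class f) x = f x}.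
Proof.
have /eqP : (\pi_aeB (repr (ae_class f)) = ae_class f)%qT by rewrite reprK.
rewrite eqmodE => /asboolP; apply: filterS => x /(_ I); exact.
Qed.

Lemma ae_eq_Lnorm1 (f g : T -> R) : measurable_fun setT f ->
  measurable_fun setT g -> {ae mu, forall x, f x = g x} ->
  ('N[mu]_1[EFin \o f] = 'N[mu]_1[EFin \o g])%E.
Proof.
move=> mf mg fg; rewrite !Lnorm1.
apply: ae_eq_integral => //.
- exact/measurableT_comp/measurable_EFinP.
- exact/measurableT_comp/measurable_EFinP.
by apply: filterS fg => x /= fgx _; rewrite fgx.
Qed.

Lemma ae_class_finite_norm (f : Lf) : finite_norm mu 1 (ae_class f).
Proof.
rewrite /finite_norm (@ae_eq_Lnorm1 _ f) => //.
- exact: Lfunction_finite.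
- exact: (@measurable_funPT _ _ _ _ (repr (ae_class f))).
- exact: ae_class_repr.
Qed.

Definition L1_pi (f : Lf) : L1 :=
  HB.pack_for (LebesgueSpace.type mu (lexx 1%E)) (ae_class f)
    (@isFinLebesgue.Build _ _ _ mu 1%E (lexx 1%E) (ae_class f)
      (ae_class_finite_norm f)).

Lemma L1_fun_pi (f : Lf) : {ae mu, forall x, L1_fun (L1_pi f) x = f x}.
Proof. exact: ae_class_repr. Qed.

Lemma L1_eqP (u v : L1) : {ae mu, forall x, L1_fun u x = L1_fun v x} -> u = v.
Proof.
move=> uv; have E : LebesgueSpace.sort u = LebesgueSpace.sort v.
  rewrite -[LHS]reprK -[RHS]reprK; apply/eqP; rewrite eqmodE; apply/asboolP.
  by apply: filterS uv.
case: u v E {uv} => [u [[ku]]] [v [[kv]]] /= E.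
by case: _ / E kv => kv; rewrite (Prop_irrelevance ku kv).
Qed.

Definition L1_zero : L1 := L1_pi 0.
Definition L1_opp (u : L1) : L1 := L1_pi (- L1_repr u).
Definition L1_add (u v : L1) : L1 := L1_pi (L1_repr u + L1_repr v).
Definition L1_scale (a : R) (u : L1) : L1 := L1_pi (a *: L1_repr u).

Let zeroE : {ae mu, forall x, L1_fun L1_zero x = 0}.
Proof. exact: L1_fun_pi. Qed.
Let oppE u : {ae mu, forall x, L1_fun (L1_opp u) x = - L1_fun u x}.
Proof. exact: L1_fun_pi. Qed.
Let addE u v :
  {ae mu, forall x, L1_fun (L1_add u v) x = L1_fun u x + L1_fun v x}.
Proof. exact: L1_fun_pi. Qed.
Let scaleE a u : {ae mu, forall x, L1_fun (L1_scale a u) x = a * L1_fun u x}.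
Proof. exact: L1_fun_pi. Qed.

Lemma L1_addA : associative L1_add.
Proof.
move=> u v w; apply: L1_eqP.
apply: filterS (filterI (filterI (addE u (L1_add v w)) (addE v w))
  (filterI (addE (L1_add u v) w) (addE u v))) => x /= [[-> ->] [-> ->]].
exact: addrA.
Qed.

Lemma L1_addC : commutative L1_add.
Proof.
move=> u v; apply: L1_eqP.
apply: filterS (filterI (addE u v) (addE v u)) => x /= [-> ->]; exact: addrC.
Qed.

Lemma L1_add0 : left_id L1_zero L1_add.
Proof.
move=> u; apply: L1_eqP.
apply: filterS (filterI (addE L1_zero u) zeroE) => x /= [-> ->].
exact: add0r.
Qed.

Lemma L1_addN : left_inverse L1_zero L1_opp L1_add.
Proof.
move=> u; apply: L1_eqP.
apply: filterS (filterI (filterI (addE (L1_opp u) u) (oppE u)) zeroE).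
by move=> x /= [[-> ->] ->]; exact: addNr.
Qed.

HB.instance Definition _ :=
  GRing.isZmodule.Build L1 L1_addA L1_addC L1_add0 L1_addN.

Lemma L1_scaleA a b u : L1_scale a (L1_scale b u) = L1_scale (a * b) u.
Proof.
apply: L1_eqP.
apply: filterS (filterI (filterI (scaleE a (L1_scale b u)) (scaleE b u))
  (scaleE (a * b) u)) => x /= [[-> ->] ->]; exact: mulrA.
Qed.

Lemma L1_scale1 : left_id 1 L1_scale.
Proof.
move=> u; apply: L1_eqP.
by apply: filterS (scaleE 1 u) => x /= ->; exact: mul1r.
Qed.

Lemma L1_scaleDr : right_distributive L1_scale +%R.
Proof.
move=> a u v; apply: L1_eqP.
apply: filterS (filterI (filterI (scaleE a (u + v)) (addE u v))
  (filterI (addE (L1_scale a u) (L1_scale a v))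
    (filterI (scaleE a u) (scaleE a v)))).
by move=> x /= [[-> ->] [-> [-> ->]]]; exact: mulrDr.
Qed.

Lemma L1_scaleDl u : {morph L1_scale ^~ u : a b / a + b}.
Proof.
move=> a b; apply: L1_eqP.
apply: filterS (filterI (scaleE (a + b) u)
  (filterI (addE (L1_scale a u) (L1_scale b u))
    (filterI (scaleE a u) (scaleE b u)))).
by move=> x /= [-> [-> [-> ->]]]; exact: mulrDl.
Qed.

HB.instance Definition _ :=
  GRing.Zmodule_isLmodule.Build R L1 L1_scaleA L1_scale1 L1_scaleDr L1_scaleDl.

Definition L1_norm (u : L1) : R := fine ('N[mu]_1[EFin \o L1_fun u])%E.

Lemma L1_normK u : ((L1_norm u)%:E = 'N[mu]_1[EFin \o L1_fun u])%E.
Proof. exact: (finite_norm_fine (L1_repr u)). Qed.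

Lemma L1_norm_pi f : ((L1_norm (L1_pi f))%:E = 'N[mu]_1[EFin \o f])%E.
Proof.
rewrite L1_normK; apply: ae_eq_Lnorm1 => //; last exact: L1_fun_pi.
exact: (Lfun_measurable (L1_repr (L1_pi f))).
Qed.

Lemma L1_normD u v : L1_norm (u + v) <= L1_norm u + L1_norm v.
Proof.
rewrite -lee_fin EFinD L1_norm_pi !L1_normK.
by apply: eminkowski => //; exact: (Lfun_measurable (L1_repr _)).
Qed.

Lemma L1_normZ (a : R) u : L1_norm (a *: u) = `|a| * L1_norm u.
Proof.
apply: EFin_inj; rewrite EFinM L1_norm_pi L1_normK.
exact: (LnormZ (L1_repr u)).
Qed.

Lemma L1_norm_eq0 u : L1_norm u = 0 -> u = 0.
Proof.
move=> u0; apply: L1_eqP.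
have := @fine_Lnormr_eq0 _ _ _ _ _ _ (L1_repr u) u0.
move=> u0'; apply: filterS (filterI u0' zeroE) => x /= [+ ->].
exact.
Qed.

HB.instance Definition _ := Lmodule_isNormed.Build R L1
  L1_normD L1_normZ L1_norm_eq0.
End L1.

Definition L1_predual {R : realType} (X : normedModType R) : Prop :=
  exists (d : measure_display) (Omega : measurableType d)
    (mu : {measure set Omega -> \bar R}) (T : {linear dual X -> L1 mu}),
    isometric_isomorphism T.

(* Main.v *)
(* A Banach space is Hahn-Banach smooth exactly when, for every norm-one [f] in
   the dual and [u] in the bidual, the greatest value at [u] of a norm-one
   extension of [f], namely the infimum over [x] of [`|u - x| + f x], is [u f].
   Approximate minimizers [x] for [u] and [- u] exhibit a weak-star
   neighbourhood of [f] on which [u] is nearly constant on the sphere; so the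
   weak-star and weak topologies agree there.  The converse is Helly's theorem.
   If moreover the dual is an [L1] space, the same infimum formula shows that
   the extreme points of its ball have dense linear span, because the norm of
   [x] is attained at an extreme point.  Extreme points of the ball of [L1] are
   either proportional or disjointly supported, so one out of each pair
   [e], [- e] gives an [ell1] basis of the dual.  On the sphere of [ell1] the
   weak-star, weak and norm topologies coincide. *)
Require Import Defs.
From HB Require Import structures.
From mathcomp Require Import all_boot all_order all_algebra.
From mathcomp Require Import all_classical all_reals all_analysis.
From mathcomp Require Import measurable_realfun lra ring.

Set Implicit Arguments.
Unset Strict Implicit.
Unset Printing Implicit Defensive.

Import Order.TTheory GRing.Theory Num.Theory.
Import numFieldNormedType.Exports.
Local Open Scope classical_set_scope.
Local Open Scope ring_scope.

(** * Extreme Hahn-Banach functionals *)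

(** One Hahn-Banach lemma serves twice. Applied to an infimal convolution it yields the norm-one
    extension that is largest at a given vector; applied to the norm of [X] it yields an extreme
    point of the dual ball, without weak-star compactness. To obtain extremality, a convex set of
    dominated functionals is represented by its sublinear support functional, so that faces become
    functions on the space and Zorn's lemma runs on these. Smoothness is what makes the span of the
    extreme points dense in norm, where Krein-Milman alone would give weak-star density. Norm
    density is the right notion because the map from [ell1] to the dual is isometric, so
    completeness of [ell1] closes its range. The equivalence is a cycle. The same [T] passes from
    (b) to (c). From (c) to (a), [T] carries the weak topology of the dual to that of [ell1], so its
    continuity on the sphere compares the weak-star and weak topologies of the dual. *)

Section extreme_hahn_banach.
Context {R : realType} (V : lmodType R).
Implicit Types (p q : V -> R) (g h k : {linear V -> R^o}).

Definition sublinear p :=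
  (forall x y, p (x + y) <= p x + p y) /\
  (forall t x, 0 <= t -> p (t *: x) = t * p x).

Lemma sublinear0 p : sublinear p -> p 0 = 0.
Proof. by move=> [_ pZ]; rewrite -(scale0r 0) pZ// mul0r. Qed.

Lemma sublinear_ge p x : sublinear p -> - p (- x) <= p x.
Proof.
move=> sp; have := sp.1 x (- x); rewrite subrr (sublinear0 sp) => H.
by rewrite lerNl -subr_ge0 opprK addrC.
Qed.

(* [q] describes a face of the convex set of the linear functionals
   dominated by [p]. *)
Definition face p q := [/\ sublinear q, forall x, q x <= p x &
  forall h k, (forall x, h x <= p x) -> (forall x, k x <= p x) ->
    (forall x, h x + k x <= 2 * q x) -> forall x, h x <= q x].

Lemma face_refl p : sublinear p -> face p p.
Proof. by []. Qed.

(* The sublinear functional of the subface on which evaluation at [x] is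
   maximal. *)
Definition exposed q x y :=
  inf [set q (y + t *: x) - t * q x | t in [set t | 0 <= t]].

Section exposed.
Variables (p q : V -> R) (x : V).
Hypothesis fq : face p q.

Let sq : sublinear q. Proof. by case: fq. Qed.

Lemma exposed_has_inf y :
  has_inf [set q (y + t *: x) - t * q x | t in [set t | 0 <= t]].
Proof.
split; first by exists (q (y + 0 *: x) - 0 * q x), 0 => /=.
exists (- q (- y)) => _ [t /= t0 <-].
have := sq.1 (y + t *: x) (- y); rewrite addrAC subrr add0r sq.2//.
lra.
Qed.

Lemma exposed_le y t : 0 <= t -> exposed q x y <= q (y + t *: x) - t * q x.
Proof.
move=> t0; apply: ge_inf; first by case: (exposed_has_inf y).
by exists t.
Qed.

Lemma le_exposed y m :
  (forall t, 0 <= t -> m <= q (y + t *: x) - t * q x) -> m <= exposed q x y.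
Proof.
move=> mq; apply: lb_le_inf; first by case: (exposed_has_inf y).
by move=> _ [t /= t0 <-]; exact: mq.
Qed.

Lemma exposed_le_self y : exposed q x y <= q y.
Proof. by have := exposed_le y (lexx 0); rewrite scale0r mul0r addr0 subr0. Qed.

Lemma exposedN : exposed q x (- x) <= - q x.
Proof.
have := exposed_le (- x) ler01.
by rewrite scale1r addNr (sublinear0 sq) mul1r sub0r.
Qed.

Lemma exposed_sublinear : sublinear (exposed q x).
Proof.
split=> [y z|s y].
  (* Parameters [t] for [y] and [u] for [z] add up to the admissible parameter [t + u] for
     [y + z]. *)
  rewrite -lerBlDr; apply: le_exposed => t t0; rewrite lerBlDr -lerBlDl.
  apply: le_exposed => u u0; rewrite lerBlDl.
  apply: le_trans (exposed_le (y + z) (addr_ge0 t0 u0)) _.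
  have := sq.1 (y + t *: x) (z + u *: x); rewrite addrACA -scalerDl.
  lra.
rewrite le_eqVlt => /predU1P[<-|s0].
  rewrite scale0r mul0r; apply/eqP; rewrite eq_le; apply/andP; split.
    by rewrite (le_trans (exposed_le_self 0))// (sublinear0 sq).
  apply: le_exposed => t t0; rewrite add0r sq.2// subrr//.
have lex r w : 0 < r -> exposed q x (r *: w) <= r * exposed q x w.
  move=> r0; rewrite -ler_pdivrMl//; apply: le_exposed => t t0.
  rewrite ler_pdivrMl//.
  apply: le_trans (exposed_le (r *: w) (mulr_ge0 (ltW r0) t0)) _.
  by rewrite -scalerA -scalerDr sq.2 ?(ltW r0)// mulrBr mulrA.
apply/eqP; rewrite eq_le lex//= -ler_pdivlMl//.
by rewrite -{1}[y](scalerK (lt0r_neq0 s0)) lex// invr_gt0.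
Qed.

(** Both [h] and [k] are below [q], since [q] is a face. At [- x] the bound
    [exposed q x (- x) <= - q x] forces [h x = k x = q x], and then [h y = h (y + t *: x) - t * h x]
    is below every term of the infimum. *)
Lemma exposed_face : face p (exposed q x).
Proof.
have [_ qp fqp] := fq; split; first exact: exposed_sublinear.
  by move=> y; rewrite (le_trans (exposed_le_self y)).
move=> h k hp kp hk.
have hq : forall y, h y + k y <= 2 * q y.
  by move=> y; rewrite (le_trans (hk y))// ler_pM2l// exposed_le_self.
have h1 := fqp _ _ hp kp hq.
have k1 : forall y, k y <= q y by apply: fqp kp hp _ => y; rewrite addrC.
have hx : h x = q x.
  apply/eqP; rewrite eq_le h1/=.
  have := hk (- x); have := exposedN; have := k1 x; rewrite !linearN/=.
  rewrite -[- h x + - k x]/(- (h x : R) - (k x : R)); lra.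
move=> y; apply: le_exposed => t t0; rewrite lerBrDr -{1}hx.
by have := h1 (y + t *: x); rewrite linearD linearZ.
Qed.

End exposed.

(** Minimality gives [exposed q x = q] for every [x], so [exposedN] makes [q] odd; an odd sublinear
    functional is linear. *)
Lemma face_minimal_linear p q : face p q ->
  (forall r, face p r -> (forall x, r x <= q x) -> r = q) ->
  linear (q : V -> R^o).
Proof.
move=> fq minq; have [sq _ _] := fq.
have qN x : q (- x) = - q x.
  apply/eqP; rewrite eq_le; apply/andP; split; last first.
    by rewrite lerNl sublinear_ge.
  have {1}<- := minq _ (exposed_face x fq) (fun y => exposed_le_self x fq y).
  exact: exposedN.
have qD x y : q (x + y) = q x + q y.
  apply/eqP; rewrite eq_le sq.1/= -lerN2 -qN !opprD -!qN; exact: sq.1.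
move=> a x y; rewrite qD; congr (_ + _).
have [a0|a0] := leP 0 a; first exact: sq.2.
have : q (- a *: x) = - a * q x by apply: sq.2; rewrite oppr_ge0 ltW.
by rewrite scaleNr qN mulNr => /oppr_inj.
Qed.

(** The pointwise infimum plays the part of the intersection of a chain of faces; it is finite
    because all members are above [- p (- x)]. Totality is needed for subadditivity: of the members
    chosen for [x] and for [y], the smaller one serves at both points. *)
Lemma face_chain p (A : set (V -> R)) : A !=set0 -> A `<=` face p ->
  (forall q r, A q -> A r ->
     (forall x, q x <= r x) \/ (forall x, r x <= q x)) ->
  face p (fun x => inf [set q x | q in A]).
Proof.
move=> [q0 Aq0] Af tot.
have hi x : has_inf [set q x | q in A].
  split; first by exists (q0 x), q0.
  exists (- p (- x)) => _ [q /Af[sq qp _] <-].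
  by rewrite (le_trans _ (sublinear_ge _ sq))// lerN2.
have le_q q x : A q -> inf [set q x | q in A] <= q x.
  by move=> Aq; apply: ge_inf; [case: (hi x)|exists q].
have q_le m x : (forall q, A q -> m <= q x) -> m <= inf [set q x | q in A].
  by move=> mq; apply: lb_le_inf; [case: (hi x)|move=> _ [q Aq <-]; exact: mq].
split.
- split=> [x y|t x].
    rewrite -lerBlDr; apply: (q_le) => q Aq; rewrite lerBlDr -lerBlDl.
    apply: q_le => r Ar; rewrite lerBlDl.
    have [qr|rq] := tot q r Aq Ar.
      rewrite (le_trans (le_q q _ Aq))//.
      by case: (Af q Aq) => [[qD _] _ _]; rewrite (le_trans (qD _ _))// lerD2l.
    case: (Af r Ar) => [[qD _] _ _].
    by rewrite (le_trans (le_q r _ Ar))// (le_trans (qD _ _))// lerD2r.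
  rewrite le_eqVlt => /predU1P[<-|t0].
    rewrite scale0r mul0r; apply/eqP; rewrite eq_le; apply/andP; split.
      by case: (Af _ Aq0) => s0 _ _; rewrite -(sublinear0 s0); exact: le_q.
    by apply: q_le => q /Af[sq _ _]; rewrite (sublinear0 sq).
  apply/eqP; rewrite eq_le; apply/andP; split.
    rewrite -ler_pdivrMl//; apply: q_le => q Aq; rewrite ler_pdivrMl//.
    case: (Af q Aq) => [[_ qZ] _ _]; rewrite -qZ ?(ltW t0)//; exact: le_q.
  apply: q_le => q Aq; case: (Af q Aq) => [[_ qZ] _ _].
  by rewrite qZ ?(ltW t0)// ler_pM2l//; exact: le_q.
- by move=> x; case: (Af _ Aq0) => _ q0p _; rewrite (le_trans (le_q q0 _ Aq0)).
- move=> h k hp kp hk x; apply: q_le => q Aq.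
  case: (Af q Aq) => _ _ fqp; apply: fqp hp kp _ x => x.
  by rewrite (le_trans (hk x))// ler_pM2l//; exact: le_q.
Qed.

(* A minimal face consists of a single, hence extreme, functional. *)
Lemma extreme_hahn_banach p x0 : sublinear p ->
  exists g, [/\ forall x, g x <= p x, g x0 = p x0 &
    forall h k, (forall x, h x <= p x) -> (forall x, k x <= p x) ->
      (forall x, h x + k x = 2 * g x) -> forall x, h x = g x].
Proof.
(* Staying below [exposed p x0] forces the value [p x0] at [x0]. Faces below a member of [F] are
   again in [F], so minimality within [F] is minimality among all faces. [Rel] is the reversed
   order, which turns Zorn's maximal element into a minimal face. *)
move=> sp; pose P q := face p q /\ forall x, q x <= exposed p x0 x.
pose F := {q | P q}.
have fp := face_refl sp.
have f0 : face p (exposed p x0) := exposed_face x0 fp.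
pose Rel (q r : F) := `[< forall x, sval r x <= sval q x >].
have [||||[q [fq qx0]] maxq] := @Zorn F Rel.
- by move=> q; apply/asboolP.
- move=> q r s /asboolP qr /asboolP rs; apply/asboolP => x.
  exact: le_trans (rs x) (qr x).
- move=> [q fq] [r fr] /asboolP/= qr /asboolP/= rq; apply: eq_exist.
  by apply/funext => x; apply/eqP; rewrite eq_le qr rq.
- move=> A totA; have [->|/set0P[q Aq]] := eqVneq A set0.
    by exists (exist P (exposed p x0) (conj f0 (fun=> lexx _))).
  have fA : face p (fun x => inf [set r x | r in [set sval s | s in A]]).
    apply: face_chain; first by exists (sval q), q.
      by move=> _ [r Ar <-]; case: (svalP r).
    move=> _ _ [r Ar <-] [s As <-].
    by case: (totA r s Ar As) => /asboolP; [right|left].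
  have leA r x : A r -> inf [set r x | r in [set sval s | s in A]] <= sval r x.
    move=> Ar; apply: ge_inf; last by exists (sval r) => //; exists r.
    exists (- p (- x)) => _ [_ [s As <-] <-]; have [[ss sp' _] _] := svalP s.
    by rewrite (le_trans _ (sublinear_ge _ ss))// lerN2.
  have [_ qx] := svalP q.
  exists (exist P _ (conj fA (fun x => le_trans (leA q x Aq) (qx x)))) => r Ar.
  by apply/asboolP => x; exact: leA.
have minq r : face p r -> (forall x, r x <= q x) -> r = q.
  move=> fr rq; have rx x : r x <= exposed p x0 x by rewrite (le_trans (rq x)).
  have /(_ _)/(congr1 sval) := maxq (exist P r (conj fr rx)).
  by apply; apply/asboolP.
pose L := GRing.isLinear.Build R V R^o *:%R q (face_minimal_linear fq minq).
pose g : {linear V -> R^o} := HB.pack (q : V -> R^o) L.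
have [sq qp fqp] := fq.
exists g; split=> //.
  apply/eqP; rewrite eq_le qp/= -lerN2 -[- g x0](linearN g).
  exact: le_trans (qx0 _) (exposedN _ fp).
have le_h h k : (forall x, h x <= p x) -> (forall x, k x <= p x) ->
    (forall x, h x + k x = 2 * g x) -> forall x, h x <= q x.
  by move=> hp kp hk; apply: fqp hp kp _ => x; rewrite hk.
move=> h k hp kp hk x; apply/eqP; rewrite eq_le (le_h h k)//=.
have := le_h h k hp kp hk (- x); rewrite linearN.
by rewrite -[q (- x)]/(g (- x)) linearN lerN2.
Qed.

End extreme_hahn_banach.

(** * Norm-preserving extensions and extreme points *)

Section dual_norm.
Context {R : realType} (V : normedModType R).
Implicit Types (f g : dual V) (x : V).

Lemma dual_applyD f g x : (f + g) x = f x + g x :> R. Proof. by []. Qed.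
Lemma dual_applyN f x : (- f) x = - f x :> R. Proof. by []. Qed.
Lemma dual_applyB f g x : (f - g) x = f x - g x :> R. Proof. by []. Qed.

Lemma dual_apply_le f x : `|f x : R| <= `|f| * `|x|.
Proof. exact: dual_norm_bound. Qed.

Lemma dual_norm_le_bound f (M : R) : 0 <= M ->
  (forall x, (f x : R) <= M * `|x|) -> `|f| <= M.
Proof.
move=> M0 fM; apply: dual_norm_le => x x1.
have Mx : M * `|x| <= M by rewrite ler_piMr.
rewrite ler_norml (le_trans (fM x) Mx) andbT lerNl -(linearN f).
by rewrite (le_trans (fM _))// normrN.
Qed.

(** Brings the algebraic functionals supplied by Zorn's lemma into the dual: the one-sided bound at
    [x] and [- x] gives continuity. *)
Lemma dominated_dual (h : {linear V -> R^o}) (M : R) : 0 <= M ->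
  (forall x, (h x : R) <= M * `|x|) -> exists2 f : dual V, f =1 h & `|f| <= M.
Proof.
move=> M0 hM.
have habs x : `|h x : R| <= M * `|x|.
  by rewrite ler_norml hM andbT lerNl -(linearN h) -[`|x|]normrN.
have hd : (h : V -> R^o) \in is_dual.
  apply/is_dualP; split; first exact: linearP.
  apply/bounded_linear_continuous/linear_boundedP.
  near=> r => x; rewrite (le_trans (habs x))// ler_wpM2r//.
by exists (Dual hd) => //; apply: dual_norm_le_bound.
Unshelve. all: by end_near. Qed.

End dual_norm.

Section canonical_embedding.
Context {R : realType} (V : normedModType R).

Lemma canonical_embeddingP : linear (@canonical_embedding R V).
Proof.
by move=> a x y; apply: dualP => f /=; rewrite linearP.
Qed.

HB.instance Definition _ := GRing.isLinear.Build R V (dual (dual V)) *:%R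
  (@canonical_embedding R V) canonical_embeddingP.

Lemma canonical_embedding_norm_le (x : V) : `|canonical_embedding x| <= `|x|.
Proof.
apply: dual_norm_le_bound => // f; rewrite mulrC.
exact: le_trans (ler_norm _) (dual_apply_le f x).
Qed.

Lemma extension_norm_ge (f : dual V) (F : dual (dual (dual V))) :
  (forall x, F (canonical_embedding x) = f x) -> `|f| <= `|F|.
Proof.
move=> Ff; apply: dual_norm_le_bound => // x; rewrite -Ff.
rewrite (le_trans (ler_norm _))// (le_trans (dual_apply_le _ _))//.
by rewrite ler_wpM2l// canonical_embedding_norm_le.
Qed.

End canonical_embedding.

(** On a dual space no norming functional has to be constructed: [canonical_embedding f] extends [f]
    to the bidual, and an extension has at least the norm of [f]. *)
Lemma canonical_embedding_dual_norm {R : realType} (V : normedModType R)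
  (f : dual V) : `|canonical_embedding f| = `|f|.
Proof.
apply/eqP; rewrite eq_le canonical_embedding_norm_le/=.
exact: extension_norm_ge.
Qed.

Lemma norm_sublinear {R : realType} (V : normedModType R) :
  sublinear (fun x : V => `|x|).
Proof.
by split=> [x y|t x t0]; [exact: ler_normD|rewrite normrZ ger0_norm].
Qed.

Section extremal_extension.
Context {R : realType} (V : normedModType R) (M : set V) (phi : dual V).
Hypothesis M0 : M 0.
Hypothesis MD : forall a x y, M x -> M y -> M (a *: x + y).
Hypothesis phi1 : `|phi| <= 1.

Let MZ a x : M x -> M (a *: x).
Proof. by move=> Mx; rewrite -[_ *: _]addr0; exact: MD. Qed.

(** The infimal convolution of the norm with [phi] on [M]. The linear functionals it dominates are
    exactly those of norm at most 1 that agree with [phi] on [M]. *)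
Definition extension_bound (v : V) : R := inf [set `|v - m| + phi m | m in M].

Lemma extension_bound_has_inf v : has_inf [set `|v - m| + phi m | m in M].
Proof.
split; first by exists (`|v - 0| + phi 0), 0.
exists (phi v) => _ [m Mm <-]; rewrite -lerBlDr.
have := dual_apply_le phi (v - m).
rewrite linearB/= => /(le_trans (ler_norm _)).
by move=> /le_trans; apply; rewrite ler_piMl.
Qed.

Lemma extension_bound_le v m : M m -> extension_bound v <= `|v - m| + phi m.
Proof.
by move=> Mm; apply: ge_inf; [case: (extension_bound_has_inf v)|exists m].
Qed.

Lemma le_extension_bound v y :
  (forall m, M m -> y <= `|v - m| + phi m) -> y <= extension_bound v.
Proof.
move=> yM; apply: lb_le_inf; first by case: (extension_bound_has_inf v).
by move=> _ [m Mm <-]; exact: yM.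
Qed.

Lemma extension_bound_sublinear : sublinear extension_bound.
Proof.
split=> [v w|t v].
  rewrite -lerBlDr; apply: le_extension_bound => m Mm; rewrite lerBlDr -lerBlDl.
  apply: le_extension_bound => n Mn; rewrite lerBlDl.
  have Mmn : M (m + n) by rewrite -[m]scale1r; exact: MD.
  apply: le_trans (extension_bound_le (v + w) Mmn) _.
  rewrite (linearD phi) opprD addrACA.
  have := ler_normD (v - m) (w - n).
  rewrite -[phi m + phi n]/((phi m : R) + (phi n : R)); lra.
rewrite le_eqVlt => /predU1P[<-|t0].
  rewrite scale0r mul0r; apply/eqP; rewrite eq_le; apply/andP; split.
    apply: le_trans (extension_bound_le 0 M0) _.
    by rewrite subr0 normr0 (linear0 phi) addr0.
  apply: le_extension_bound => m _; rewrite sub0r normrN.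
  have := dual_apply_le phi m; rewrite ler_norml => /andP[+ _].
  have : `|phi| * `|m| <= `|m| by rewrite ler_piMl.
  lra.
have le_t r w : 0 < r -> extension_bound (r *: w) <= r * extension_bound w.
  move=> r0; rewrite -ler_pdivrMl//; apply: le_extension_bound => m Mm.
  rewrite ler_pdivrMl// (le_trans (extension_bound_le _ (MZ r Mm)))//.
  by rewrite -scalerBr normrZ gtr0_norm// linearZ mulrDr.
apply/eqP; rewrite eq_le le_t//= -ler_pdivlMl//.
by rewrite -{1}[v](scalerK (lt0r_neq0 t0)) le_t// invr_gt0.
Qed.

(* The extension of [phi] from [M] that is largest at [v]. *)
Lemma extremal_extension v : exists F : dual V, [/\ `|F| <= 1,
  forall m, M m -> F m = phi m & F v = extension_bound v].
Proof.
have [h [hp hv _]] := extreme_hahn_banach v extension_bound_sublinear.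
have [x|F Fh F1] := @dominated_dual _ _ h 1 ler01.
  apply: le_trans (hp x) (le_trans (extension_bound_le x M0) _).
  by rewrite (linear0 phi) subr0 addr0 mul1r.
exists F; split=> //; last by rewrite Fh.
have le_F m : M m -> F m <= phi m.
  move=> Mm; rewrite Fh; apply: le_trans (hp m) _.
  by apply: le_trans (extension_bound_le m Mm) _; rewrite subrr normr0 add0r.
move=> m Mm; apply/eqP; rewrite eq_le le_F//=.
have := le_F _ (MZ (-1) Mm).
by rewrite scaleN1r (linearN F) (linearN phi) lerN2.
Qed.

End extremal_extension.

Lemma hahn_banach_smooth_approx {R : realType} (X : normedModType R) :
  hahn_banach_smooth X -> forall (f : dual X) (u : dual (dual X)) (e : R),
  `|f| = 1 -> 0 < e ->
  exists x, `|u - canonical_embedding x| + f x < u f + e.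
Proof.
move=> hX f u e f1 e0.
pose M := range (@canonical_embedding R X).
have M0 : M 0 by exists 0 => //; rewrite linear0.
have MD a v w : M v -> M w -> M (a *: v + w).
  by move=> [x _ <-] [y _ <-]; exists (a *: x + y) => //; rewrite linearP.
have phi1 : `|canonical_embedding f| <= 1.
  by rewrite canonical_embedding_dual_norm f1.
have [F [F1 FM Fu]] := extremal_extension M0 MD phi1 u.
(* [F] and [canonical_embedding f] are both norm-preserving extensions of [f]; uniqueness identifies
   them, so the infimum, which is [F u], equals [u f]. *)
have Ff x : F (canonical_embedding x) = f x by rewrite FM//; exists x.
have [G [_ Gu]] := hX f.
have GF : G = F.
  apply: Gu; split=> //; apply/eqP; rewrite eq_le (extension_norm_ge Ff) andbT.
  by rewrite f1.
have Gf : G = canonical_embedding f.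
  by apply: Gu; split=> //; exact: canonical_embedding_dual_norm.
have [_ [_ [x _ <-] <-]] :=
  inf_adherent e0 (extension_bound_has_inf M0 phi1 u).
rewrite -[inf _]/(extension_bound M (canonical_embedding f) u) -Fu -GF Gf.
by exists x.
Qed.

(** The midpoint form avoids convex coefficients; [g = e] already yields [h = 2 *: e - g = e]. *)
Definition extreme_point {R : realType} {V : normedModType R} : set V :=
  [set e | `|e| = 1 /\ forall g h : V, `|g| <= 1 -> `|h| <= 1 ->
                         g + h = 2 *: e -> g = e].

Section extreme_point.
Context {R : realType}.

(** The linear functionals dominated by the norm form the unit ball of the dual, so extremality
    among them is extremality in the ball. That [x] is nonzero turns [e x = |x|] into [1 <= |e|]. *)
Lemma norming_extreme_point (V : normedModType R) (x : V) : x != 0 ->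
  exists2 e : dual V, extreme_point e & e x = `|x|.
Proof.
move=> x0; have [h [h1 hx hext]] := extreme_hahn_banach x (norm_sublinear V).
have [y|e eh e1] := @dominated_dual _ _ h 1 ler01; first by rewrite mul1r.
have le_norm (f : dual V) : `|f| <= 1 -> forall y, (f y : R) <= `|y|.
  move=> f1 y; rewrite (le_trans (ler_norm _))//.
  by rewrite (le_trans (dual_apply_le f y))// ler_piMl.
exists e; last by rewrite eh.
split=> [|f g f1 g1 fg].
  apply/eqP; rewrite eq_le e1/= -(ler_pM2r (_ : 0 < `|x|)) ?normr_gt0//.
  by rewrite mul1r -{1}hx -eh (le_trans (ler_norm _))// dual_apply_le.
apply: dualP => y; rewrite eh.
apply: (hext f g) => [z|z|z]; [exact: le_norm|exact: le_norm|].
by rewrite -[LHS]/((f + g) z) fg -eh.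
Qed.

(* For [t = `|a|], [e] is the midpoint of [(2 - t) a + (1 - t) b] and
   [t a + (1 + t) b]. *)
Lemma extreme_point_summand (V : normedModType R) (e a b : V) :
  extreme_point e -> e = a + b -> `|a| + `|b| <= 1 -> a = `|a| *: e.
Proof.
move=> [_ ext_e] eab ab1; set t := `|a| in ab1 *.
have t0 : 0 <= t by exact: normr_ge0.
have t1 : t <= 1 by rewrite (le_trans _ ab1)// lerDl.
have bt : `|b| <= 1 - t by rewrite lerBrDl.
(* Both points lie in the ball because [(2 - t) t + (1 - t)^2 = 1] and [t^2 + (1 + t) (1 - t) = 1].
   Nothing is divided by [t] or [1 - t], so [a = 0] and [b = 0] are included. Subtracting [a] from
   the identity leaves [(1 - t) e = e - a]. *)
have gE : (2 - t) *: a + (1 - t) *: b = e.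
  apply: (ext_e _ (t *: a + (1 + t) *: b)).
  - rewrite (le_trans (ler_normD _ _))// !normrZ -/t !ger0_norm ?subr_ge0//.
      have : (1 - t) * `|b| <= (1 - t) * (1 - t)
        by rewrite ler_wpM2l// subr_ge0.
      lra.
    by rewrite (le_trans t1)// ler1n.
  - rewrite (le_trans (ler_normD _ _))// !normrZ -/t !ger0_norm ?addr_ge0//.
    have : (1 + t) * `|b| <= (1 + t) * (1 - t) by rewrite ler_wpM2l// addr_ge0.
    lra.
  - rewrite addrACA -!scalerDl eab scalerDr subrK.
    by congr (_ + _); rewrite -addrA (addrCA (- t)) addNr addr0.
have : (1 - t) *: a + (1 - t) *: b = e - a.
  rewrite -gE addrAC -[X in _ = _ - X + _]scale1r -scalerBl.
  by congr (_ *: _ + _); ring.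
by rewrite -scalerDr -eab scalerBl scale1r => /addrI/oppr_inj ->.
Qed.

Lemma extreme_pointN (V : normedModType R) (e : V) :
  extreme_point e -> extreme_point (- e).
Proof.
move=> [e1 ext_e]; split=> [|g h g1 h1 gh]; first by rewrite normrN.
apply: oppr_inj; rewrite opprK; apply: (ext_e _ (- h)); rewrite ?normrN//.
by rewrite -opprD gh scalerN opprK.
Qed.

Lemma extreme_point_isometry (U V : normedModType R) (T : {linear U -> V})
  (e : U) : isometric_isomorphism T -> extreme_point e -> extreme_point (T e).
Proof.
move=> [Tnorm Tsurj] [e1 ext_e]; split=> [|g h]; first by rewrite Tnorm.
have [g' _ <-] := Tsurj g I; have [h' _ <-] := Tsurj h I.
rewrite !Tnorm => g1 h1; rewrite -linearD -linearZ => gh.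
congr (T _); apply: (ext_e _ h') => //.
apply/eqP; rewrite -subr_eq0 -normr_eq0 -Tnorm.
by rewrite linearB gh subrr normr0.
Qed.

(* Otherwise some [u] in the bidual vanishes on [M] but not at a
   norm-one [f].  An [x] making [`|- u - x| + f x] close to [- u f] would
   satisfy [`|x| <= `|u + x|], since the norm of [x] is attained at an extreme
   point, where [u] vanishes. *)
Lemma dense_span_extreme_points (X : normedModType R) (M : set (dual X)) :
  hahn_banach_smooth X -> M 0 ->
  (forall a f g, M f -> M g -> M (a *: f + g)) ->
  extreme_point `<=` M ->
  forall (f : dual X) (e : R), 0 < e -> exists2 g, M g & `|f - g| < e.
Proof.
move=> hX M0 MD extM f e e0; apply: contrapT => nearf.
have far g : M g -> e <= `|f - g|.
  by move=> Mg; rewrite leNgt; apply/negP => fg; apply: nearf; exists g.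
have f0 : 0 < `|f| by have := far 0 M0; rewrite subr0; exact: lt_le_trans.
have zero1 : `|0 : dual (dual X)| <= 1 by rewrite normr0.
(* For the zero functional on [M], the extension bound at [f] is the distance from [f] to [M]. *)
have [u [u1 uM uf]] := extremal_extension M0 MD zero1 f.
have euf : e <= u f.
  rewrite uf; apply: le_extension_bound => // g Mg.
  by rewrite -[(0 : dual _) g]/(0 : R) addr0 far.
have fn1 : `| `|f|^-1 *: f| = 1.
  by rewrite normrZ normfV normr_id mulVf// gt_eqF.
have en0 : 0 < `|f|^-1 * e by rewrite mulr_gt0// invr_gt0.
have [x] := hahn_banach_smooth_approx hX (- u) fn1 en0.
apply/negP; rewrite -leNgt.
have -> : (- u) (`|f|^-1 *: f) = - (`|f|^-1 * u f) :> R.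
  by rewrite dual_applyN linearZ.
have : `|f|^-1 * e <= `|f|^-1 * (u f : R) by rewrite ler_pM2l// invr_gt0.
have : - ((`|f|^-1 *: f) x : R) <= `|x|.
  have := dual_apply_le (`|f|^-1 *: f) x; rewrite fn1 mul1r.
  by rewrite ler_norml => /andP[+ _]; rewrite lerNl.
suff : `|x| <= `|- u - canonical_embedding x| by lra.
have [->|x0] := eqVneq x 0; first by rewrite normr0.
have [d ext_d dx] := norming_extreme_point x0.
rewrite -opprD normrN -dx.
have -> : d x = (u + canonical_embedding x) d.
  by rewrite [RHS]dual_applyD uM ?add0r//; exact: extM.
rewrite (le_trans (ler_norm _))// (le_trans (dual_apply_le _ _))//.
by rewrite (proj1 ext_d) mulr1.
Qed.

End extreme_point.

(** * Extreme points of the unit ball of L1 *)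

(** Writing the truncation of [r] to [[- s, s]] with absolute values lets it pass to classes of
    functions, with [L1_abs] as the only nonlinear operation. *)
Lemma truncateE {R : realFieldType} (r s : R) : 0 <= s ->
  2^-1 * (`|r + s| - `|r - s|) =
  if s < r then s else if r < - s then - s else r.
Proof.
move=> s0; have [sr|rs] := ltP s r.
  by rewrite !ger0_norm; lra.
have [rs'|sr] := ltP r (- s); first by rewrite !ler0_norm; lra.
by rewrite ger0_norm ?ler0_norm; lra.
Qed.

Lemma truncate_abs {R : realFieldType} (r s : R) : 0 <= s ->
  `|2^-1 * (`|r + s| - `|r - s|)| = Num.min `|r| s.
Proof.
move=> s0; rewrite truncateE//; have [sr|rs] := ltP s r.
  by rewrite !ger0_norm ?min_r//; lra.
have [rs'|sr] := ltP r (- s).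
  by rewrite normrN ger0_norm// min_r// ler0_norm; lra.
by rewrite min_l// ler_norml sr.
Qed.

(** Truncation keeps the sign and does not increase the size, so nothing cancels. Integrated, this
    is the norm additivity that [extreme_point_summand] asks for. *)
Lemma truncate_summand {R : realFieldType} (r s : R) : 0 <= s ->
  let t := 2^-1 * (`|r + s| - `|r - s|) in `|r| = `|t| + `|r - t|.
Proof.
move=> s0 t; rewrite /t truncateE//; have [sr|rs] := ltP s r.
  by rewrite !ger0_norm; lra.
have [rs'|sr] := ltP r (- s); last by rewrite subrr normr0 addr0.
by rewrite opprK !ler0_norm; lra.
Qed.

Section L1_extreme_points.
Context {d} {T : measurableType d} {R : realType}
  (mu : {measure set T -> \bar R}).
Implicit Types u v w e : L1 mu.

Lemma L1_funD u v :
  {ae mu, forall x, L1_fun (u + v) x = L1_fun u x + L1_fun v x}.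
Proof. exact: L1_fun_pi. Qed.

Lemma L1_funN u : {ae mu, forall x, L1_fun (- u) x = - L1_fun u x}.
Proof. exact: L1_fun_pi. Qed.

Lemma L1_funB u v :
  {ae mu, forall x, L1_fun (u - v) x = L1_fun u x - L1_fun v x}.
Proof.
apply: filterS (filterI (L1_funD u (- v)) (L1_funN v)) => x /= [-> ->].
by [].
Qed.

Lemma L1_funZ (a : R) u : {ae mu, forall x, L1_fun (a *: u) x = a * L1_fun u x}.
Proof. exact: L1_fun_pi. Qed.

Lemma L1_fun0 : {ae mu, forall x, L1_fun (0 : L1 mu) x = 0}.
Proof. exact: L1_fun_pi. Qed.

Lemma measurable_L1_fun u : measurable_fun setT (L1_fun u).
Proof. exact: (Lfun_measurable (L1_repr u)). Qed.

Lemma L1_norm_integral u : (`|u|%:E = \int[mu]_x (`|L1_fun u x|)%:E)%E.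
Proof. by rewrite [LHS]L1_normK Lnorm1. Qed.

Let measurable_abs u : measurable_fun setT (fun x => (`|L1_fun u x|)%:E).
Proof.
apply/measurable_EFinP; apply: measurableT_comp => //; exact: measurable_L1_fun.
Qed.

Lemma L1_normD_eq u v w :
  {ae mu, forall x, `|L1_fun w x| = `|L1_fun u x| + `|L1_fun v x|} ->
  `|w| = `|u| + `|v|.
Proof.
move=> wuv; apply: EFin_inj; rewrite EFinD !L1_norm_integral -ge0_integralD//.
apply: ae_eq_integral => //; first exact: emeasurable_funD.
by apply: filterS wuv => x /= wx _; rewrite wx.
Qed.

Lemma L1_norm_eq u v : {ae mu, forall x, `|L1_fun u x| = `|L1_fun v x|} ->
  `|u| = `|v|.
Proof.
move=> uv; apply: EFin_inj; rewrite !L1_norm_integral.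
by apply: ae_eq_integral => //; apply: filterS uv => x /= ux _; rewrite ux.
Qed.

Lemma L1_abs_subproof u : (fun x => `|L1_fun u x|) \in Lfun mu 1.
Proof. exact/Lfun_norm/L1_fun_Lfun. Qed.

Definition L1_abs u : L1 mu := L1_pi (Lfun_Sub (lexx 1%E) (L1_abs_subproof u)).

Lemma L1_fun_abs u : {ae mu, forall x, L1_fun (L1_abs u) x = `|L1_fun u x|}.
Proof. exact: L1_fun_pi. Qed.

(* [u] truncated to the interval [- |v|, |v|]. *)
Definition L1_truncate u v : L1 mu :=
  2^-1 *: (L1_abs (u + L1_abs v) - L1_abs (u - L1_abs v)).

Lemma L1_fun_truncate u v : {ae mu, forall x, L1_fun (L1_truncate u v) x =
  2^-1 * (`|L1_fun u x + `|L1_fun v x| | - `|L1_fun u x - `|L1_fun v x| |)}.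
Proof.
apply: filterS (filterI
  (filterI (L1_funZ 2^-1 (L1_abs (u + L1_abs v) - L1_abs (u - L1_abs v)))
     (L1_funB (L1_abs (u + L1_abs v)) (L1_abs (u - L1_abs v))))
  (filterI (filterI (L1_fun_abs (u + L1_abs v)) (L1_fun_abs (u - L1_abs v)))
     (filterI (filterI (L1_funD u (L1_abs v)) (L1_funB u (L1_abs v)))
        (L1_fun_abs v)))) => x /= [[-> ->] [[-> ->] [[-> ->] ->]]].
by [].
Qed.

Definition L1_disjoint u v :=
  {ae mu, forall x, L1_fun u x * L1_fun v x = 0}.

Lemma L1_disjoint0 u : L1_disjoint u 0.
Proof. by apply: filterS L1_fun0 => x /= ->; rewrite mulr0. Qed.

Lemma L1_disjoint_linear u v w a : L1_disjoint u v -> L1_disjoint u w ->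
  L1_disjoint u (a *: v + w).
Proof.
move=> uv uw; apply: filterS (filterI (filterI uv uw)
  (filterI (L1_funD (a *: v) w) (L1_funZ a v))) => x /= [[uv0 uw0] [-> ->]].
by rewrite mulrDr uw0 addr0 mulrCA uv0 mulr0.
Qed.

Lemma L1_disjoint_normD u v a : L1_disjoint u v ->
  `|a *: u + v| = `|a| * `|u| + `|v|.
Proof.
move=> uv; rewrite -normrZ; apply: L1_normD_eq.
apply: filterS (filterI uv (filterI (L1_funD (a *: u) v) (L1_funZ a u))).
move=> x /= [/eqP + [-> ->]].
by rewrite mulf_eq0 => /orP[]/eqP->; rewrite ?mulr0 ?normr0 ?addr0 ?add0r.
Qed.

(** Almost everywhere [f] is [e] or [- e], so one of [(e + f) / 2] and [(e - f) / 2] vanishes there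
    and their norms add up to that of [e]. Hence [(e + f) / 2], and with it [f], is a multiple of
    [e]. *)
Lemma extreme_points_abs e f : extreme_point e -> extreme_point f ->
  {ae mu, forall x, `|L1_fun e x| = `|L1_fun f x|} -> f = e \/ f = - e.
Proof.
move=> ext_e [f1 _] ef; have [e1 _] := ext_e.
pose p : L1 mu := 2^-1 *: (e + f); pose q : L1 mu := 2^-1 *: (e - f).
have epq : e = p + q.
  rewrite /p /q -scalerDr addrACA subrr addr0.
  have -> : e + e = 2 *: e by rewrite scaler_nat mulr2n.
  by rewrite scalerA mulVf ?scale1r// pnatr_eq0.
have pE : p = `|p| *: e.
  apply: extreme_point_summand epq _ => //.
  rewrite -e1 (_ : `|e| = `|p| + `|q|)//; apply: L1_normD_eq.
  apply: filterS (filterI (filterI ef (filterI (L1_funD e f) (L1_funB e f)))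
    (filterI (L1_funZ 2^-1 (e + f)) (L1_funZ 2^-1 (e - f)))).
  move=> x /= [[+ [Df Bf]] [-> ->]]; rewrite Df Bf => efx.
  have /orP[/eqP ->|/eqP ->] : (L1_fun f x == L1_fun e x) ||
      (L1_fun f x == - L1_fun e x).
    by rewrite -eqr_norm2 eq_sym; apply/eqP.
    rewrite subrr mulr0 normr0 addr0; congr `|_|.
    by lra.
  rewrite subrr mulr0 normr0 add0r opprK; congr `|_|.
  by lra.
have fE : f = (2 * `|p| - 1) *: e.
  rewrite scalerBl scale1r -scalerA -pE scalerA mulfV ?pnatr_eq0// scale1r.
  by rewrite addrAC subrr add0r.
move: f1; rewrite fE normrZ e1 mulr1 => /eqP.
rewrite eqr_norml ler01 andbT => /orP[] /eqP ->; first by left; rewrite scale1r.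
by right; rewrite scaleN1r.
Qed.

(** Truncating [e] by [|f|] gives a summand of [e], hence a multiple of [e]; likewise with the roles
    exchanged. Both truncations have absolute value [min |e| |f|], so the two factors are equal. If
    the factor is 0 the minimum vanishes; otherwise it cancels and [|e| = |f|]. *)
Lemma extreme_points_disjoint e f : extreme_point e -> extreme_point f ->
  [\/ L1_disjoint e f, f = e | f = - e].
Proof.
move=> ext_e ext_f; have [e1 _] := ext_e; have [f1 _] := ext_f.
have trunc u v : extreme_point u -> {ae mu, forall x,
    L1_fun (L1_truncate u v) x = `|L1_truncate u v| * L1_fun u x}.
  move=> ext_u; have [u1 _] := ext_u.
  rewrite [X in {ae mu, forall x, L1_fun X x = _}]
    (_ : _ = `|L1_truncate u v| *: u).
    exact: L1_funZ.
  apply: (@extreme_point_summand _ _ _ _ (u - L1_truncate u v)) => //.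
    by rewrite addrC subrK.
  rewrite -u1 (_ : `|u| = `|L1_truncate u v| + `|u - L1_truncate u v|)//.
  apply: L1_normD_eq.
  apply: filterS (filterI (L1_fun_truncate u v) (L1_funB u (L1_truncate u v))).
  by move=> x /= [-> ->]; exact: truncate_summand.
have abs_trunc u v : {ae mu, forall x, `|L1_fun (L1_truncate u v) x| =
    Num.min `|L1_fun u x| `|L1_fun v x|}.
  by apply: filterS (L1_fun_truncate u v) => x /= ->; exact: truncate_abs.
have tE : `|L1_truncate e f| = `|L1_truncate f e|.
  apply: L1_norm_eq; apply: filterS (filterI (abs_trunc e f) (abs_trunc f e)).
  by move=> x /= [-> ->]; rewrite minC.
have [t0|t0] := eqVneq `|L1_truncate e f| 0.
  apply: Or31; apply: filterS (filterI
      (filterI (trunc e f ext_e) (trunc f e ext_f))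
      (filterI (abs_trunc e f) (abs_trunc f e))) => x /= [[+ _] [+ _]].
  rewrite t0 mul0r => -> /esym/eqP; rewrite normr0 minEle.
  by case: ifP => _; rewrite normr_eq0 => /eqP ->; rewrite ?mul0r ?mulr0.
have ef : {ae mu, forall x, `|L1_fun e x| = `|L1_fun f x|}.
  apply: filterS (filterI
      (filterI (trunc e f ext_e) (trunc f e ext_f))
      (filterI (abs_trunc e f) (abs_trunc f e))) => x /=.
  move=> [[-> ->] []]; rewrite -tE minC => <-.
  by rewrite !normrM normr_id => /(mulfI t0).
by have [->|->] := extreme_points_abs ext_e ext_f ef; [apply: Or32|apply: Or33].
Qed.

Lemma extreme_points_norm (s : seq (L1 mu)) (b : L1 mu -> R) : uniq s ->
  {in s, forall e, extreme_point e} -> {in s &, forall e f, f <> - e} ->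
  `|\sum_(e <- s) b e *: e| = \sum_(e <- s) `|b e|.
Proof.
elim: s => [|e s IH]; first by rewrite !big_nil normr0.
move=> /= /andP[es us] ext_s opp_s; rewrite !big_cons.
have ext_e : extreme_point e by apply: ext_s; rewrite mem_head.
rewrite L1_disjoint_normD.
  rewrite (proj1 ext_e) mulr1 IH//.
    by move=> f fs; apply: ext_s; rewrite inE fs orbT.
  by move=> f g fs gs; apply: opp_s; rewrite inE ?fs ?gs orbT.
have : {in s, forall f, L1_disjoint e f}.
  move=> f fs.
  have ext_f : extreme_point f by apply: ext_s; rewrite inE fs orbT.
  have [//|fe|fe] := extreme_points_disjoint ext_e ext_f.
    by rewrite fe (negbTE es) in fs.
  by exfalso; apply: opp_s fe; rewrite ?mem_head// inE fs orbT.
elim: (s) => [|f r IHr] disj; first by rewrite big_nil; exact: L1_disjoint0.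
rewrite big_cons; apply: L1_disjoint_linear.
  by apply: disj; rewrite mem_head.
by apply: IHr => g gr; apply: disj; rewrite inE gr orbT.
Qed.

End L1_extreme_points.

Lemma L1_predual_extreme_points {R : realType} (X : normedModType R)
    (s : seq (dual X)) (b : dual X -> R) : L1_predual X -> uniq s ->
  {in s, forall e, extreme_point e} -> {in s &, forall e f, f <> - e} ->
  `|\sum_(e <- s) b e *: e| = \sum_(e <- s) `|b e|.
Proof.
move=> [d [Y [mu [T isoT]]]] us ext_s opp_s; have [Tnorm Tsurj] := isoT.
have Tinj : injective T.
  move=> f g fg; apply/eqP.
  by rewrite -subr_eq0 -normr_eq0 -Tnorm linearB fg subrr normr0.
(* An inverse of [T], used only to read the coefficients [b] on the images [T e]; there the default
   0 is never taken. *)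
pose S u := xget 0 [set f | T f = u].
have TS f : S (T f) = f.
  by apply: Tinj; exact: (@xgetI _ _ [set g | T g = T f] f).
rewrite -Tnorm linear_sum/= (eq_bigr (fun e => b (S (T e)) *: T e)); last first.
  by move=> e _; rewrite TS linearZ.
rewrite -(big_map T xpredT (fun u => b (S u) *: u)) extreme_points_norm.
- by rewrite big_map; apply: eq_bigr => e _; rewrite TS.
- by rewrite map_inj_uniq.
- by move=> _ /mapP[e es ->]; exact: extreme_point_isometry (ext_s e es).
- move=> _ _ /mapP[e es ->] /mapP[f fs ->]; rewrite -linearN => /Tinj.
  exact: opp_s.
Qed.

(** * Synthesis over ell1 *)

Section esum_seq.
Context {R : realType} {I : choiceType}.
Implicit Types (a : I -> R) (s : seq I).

Lemma esum_ge_seq a s : uniq s -> ((\sum_(i <- s) a i)%:E <=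
  \esum_(i in [set: I]) (a i)%:E)%E.
Proof.
move=> us; apply: esum_ge; exists [set` s].
  by split=> //; exact: finite_seq.
by rewrite -fsbig_seq// sumEFin.
Qed.

Lemma esum_le_seq a (M : R) : (forall s, uniq s -> \sum_(i <- s) a i <= M) ->
  (\esum_(i in [set: I]) (a i)%:E <= M%:E)%E.
Proof.
move=> aM; apply: ge_ereal_sup => _ [A [finA _] <-].
by rewrite fsbig_finite//= sumEFin lee_fin aM// fset_uniq.
Qed.

Definition nonneg_sum a : R := fine (\esum_(i in [set: I]) (a i)%:E)%E.

Definition nonneg_summable a :=
  (forall i, 0 <= a i) /\ (\esum_(i in [set: I]) (a i)%:E < +oo)%E.

Lemma nonneg_sumK a : nonneg_summable a ->
  ((nonneg_sum a)%:E = \esum_(i in [set: I]) (a i)%:E)%E.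
Proof.
move=> [a0 afin]; rewrite fineK// ge0_fin_numE//.
by apply: esum_ge0 => i _; rewrite lee_fin.
Qed.

Lemma nonneg_sumD a b : nonneg_summable a -> nonneg_summable b ->
  nonneg_summable (fun i => a i + b i) /\
  nonneg_sum (fun i => a i + b i) = nonneg_sum a + nonneg_sum b.
Proof.
move=> sa sb; have abE : (\esum_(i in [set: I]) (a i + b i)%:E =
    (nonneg_sum a + nonneg_sum b)%:E)%E.
  rewrite EFinD !nonneg_sumK// -esumD//.
  - by move=> i _; rewrite lee_fin sa.1.
  - by move=> i _; rewrite lee_fin sb.1.
split; last by rewrite /nonneg_sum abE.
by split=> [i|]; [rewrite addr_ge0// ?sa.1 ?sb.1|rewrite abE ltry].
Qed.

Lemma nonneg_sumZ c a : 0 <= c -> nonneg_summable a ->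
  nonneg_summable (fun i => c * a i) /\
  nonneg_sum (fun i => c * a i) = c * nonneg_sum a.
Proof.
move=> c0 sa; have caE : (\esum_(i in [set: I]) (c * a i)%:E =
    (c * nonneg_sum a)%:E)%E.
  rewrite EFinM nonneg_sumK// -[c in RHS]ger0_norm//.
  have := esum_normZ c (a : I -> R^o).
  under eq_esum do rewrite /= ger0_norm ?mulr_ge0 ?sa.1//.
  by under [in X in _ = X -> _]eq_esum do rewrite /= ger0_norm ?sa.1//.
split; last by rewrite /nonneg_sum caE.
by split=> [i|]; [rewrite mulr_ge0// sa.1|rewrite caE ltry].
Qed.

Lemma nonneg_sum_ge0 a : nonneg_summable a -> 0 <= nonneg_sum a.
Proof.
by move=> sa; rewrite fine_ge0// esum_ge0// => i _; rewrite lee_fin sa.1.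
Qed.

Lemma nonneg_summable_le a b : (forall i, 0 <= a i) -> (forall i, a i <= b i) ->
  nonneg_summable b -> nonneg_summable a.
Proof.
move=> a0 ab [b0 bfin]; split=> //; apply: le_lt_trans bfin.
by apply: le_esum => i _; rewrite lee_fin.
Qed.

(** Has the shape of [ell1_c0_pairing], so that results on [signed_sum] apply to that pairing by
    conversion. *)
Definition signed_sum a : R :=
  fine (\esum_(i in [set: I]) (a^\+ i)%:E)%E -
  fine (\esum_(i in [set: I]) (a^\- i)%:E)%E.

Definition abs_summable a := nonneg_summable (fun i => `|a i|).

Lemma funrpos_summable a : abs_summable a -> nonneg_summable a^\+.
Proof.
apply: nonneg_summable_le => i; first exact: funrpos_ge0.
by rewrite /funrpos; case: (leP (a i) 0) => // ?; exact: ler_norm.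
Qed.

Lemma funrneg_summable a : abs_summable a -> nonneg_summable a^\-.
Proof.
apply: nonneg_summable_le => i; first exact: funrneg_ge0.
by rewrite /funrneg -normrN; case: (leP (- a i) 0) => // ?; exact: ler_norm.
Qed.

Let posB a i : a^\+ i - a^\- i = a i.
Proof. by rewrite -[LHS]/((a^\+ - a^\-) i) funrposBneg. Qed.

Let posD a i : a^\+ i + a^\- i = `|a i|.
Proof. by rewrite -[LHS]/((a^\+ + a^\-) i) funrposDneg. Qed.

(** The value does not depend on the decomposition, because [a^\+ + c = b + a^\-] involves
    nonnegative families only. Linearity of [signed_sum] reduces to choosing suitable
    decompositions. *)
Lemma signed_sum_sub a b c : nonneg_summable b -> nonneg_summable c ->
  (forall i, a i = b i - c i) ->
  abs_summable a /\ signed_sum a = nonneg_sum b - nonneg_sum c.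
Proof.
move=> sb sc abc; have sa : abs_summable a.
  apply: nonneg_summable_le (nonneg_sumD sb sc).1 => // i.
  by rewrite abc (le_trans (ler_normB _ _))// !ger0_norm ?sb.1 ?sc.1.
split=> //; rewrite -[LHS]/(nonneg_sum a^\+ - nonneg_sum a^\-).
apply/eqP; rewrite subr_eq addrAC eq_sym subr_eq.
have [_ <-] := nonneg_sumD sb (funrneg_summable sa).
have [_ <-] := nonneg_sumD (funrpos_summable sa) sc.
apply/eqP; congr nonneg_sum; apply/funext => i.
by have := posB a i; rewrite abc; lra.
Qed.

Lemma signed_sumD a b : abs_summable a -> abs_summable b ->
  abs_summable (fun i => a i + b i) /\
  signed_sum (fun i => a i + b i) = signed_sum a + signed_sum b.
Proof.
move=> sa sb.
have [sp pE] := nonneg_sumD (funrpos_summable sa) (funrpos_summable sb).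
have [sn nE] := nonneg_sumD (funrneg_summable sa) (funrneg_summable sb).
have [|sab ->] := signed_sum_sub (a := fun i => a i + b i) sp sn.
  by move=> i; rewrite opprD addrACA !posB.
by split=> //; rewrite pE nE opprD addrACA.
Qed.

Lemma signed_sumN a : abs_summable a ->
  abs_summable (fun i => - a i) /\ signed_sum (fun i => - a i) = - signed_sum a.
Proof.
move=> sa; have [|? ->] := signed_sum_sub (a := fun i => - a i)
  (funrneg_summable sa) (funrpos_summable sa).
  by move=> i; rewrite -opprB posB.
by rewrite -opprB.
Qed.

Lemma signed_sumZ c a : abs_summable a ->
  abs_summable (fun i => c * a i) /\
  signed_sum (fun i => c * a i) = c * signed_sum a.
Proof.
have pos d b : 0 <= d -> abs_summable b -> abs_summable (fun i => d * b i) /\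
    signed_sum (fun i => d * b i) = d * signed_sum b.
  move=> d0 sb; have [sp pE] := nonneg_sumZ d0 (funrpos_summable sb).
  have [sn nE] := nonneg_sumZ d0 (funrneg_summable sb).
  have [|? ->] := signed_sum_sub (a := fun i => d * b i) sp sn.
    by move=> i; rewrite -mulrBr posB.
  by rewrite pE nE -mulrBr.
move=> sa; have [c0|/ltW c0] := leP 0 c; first exact: pos.
have [sN NE] := signed_sumN sa.
have := pos (- c) _ _ sN; rewrite oppr_ge0 NE mulrNN => /(_ c0).
by under eq_fun do rewrite mulrNN.
Qed.

Lemma signed_sum_le a (M : R) : abs_summable a ->
  (\esum_(i in [set: I]) (`|a i|)%:E <= M%:E)%E -> `|signed_sum a| <= M.
Proof.
move=> sa; rewrite -nonneg_sumK// lee_fin; apply: le_trans.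
have sp := funrpos_summable sa; have sn := funrneg_summable sa.
have -> : nonneg_sum (fun i => `|a i|) = nonneg_sum a^\+ + nonneg_sum a^\-.
  have [_ <-] := nonneg_sumD sp sn; congr nonneg_sum; apply/funext => i.
  by rewrite posD.
rewrite -[signed_sum a]/(nonneg_sum a^\+ - nonneg_sum a^\-).
by rewrite (le_trans (ler_normB _ _))// !ger0_norm// nonneg_sum_ge0.
Qed.

Lemma nonneg_sum_single j (c : R) : 0 <= c ->
  nonneg_summable (fun i => if i == j then c else 0) /\
  nonneg_sum (fun i => if i == j then c else 0) = c.
Proof.
move=> c0.
have E : (\esum_(i in [set: I]) (if i == j then c else 0)%:E = c%:E)%E.
  transitivity (\esum_(i in [set j]) c%:E)%E; last by rewrite esum_set1.
  rewrite [RHS]esum_mkcond; apply: eq_esum => i _.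
  have -> : (i \in [set j]) = (i == j) by apply/idP/eqP; rewrite inE.
  by case: ifP.
split; last by rewrite /nonneg_sum E.
by split=> [i|]; [case: ifP|rewrite E ltry].
Qed.

Lemma signed_sum_single j (c : R) :
  abs_summable (fun i => if i == j then c else 0) /\
  signed_sum (fun i => if i == j then c else 0) = c.
Proof.
have pos d : 0 <= d -> abs_summable (fun i => if i == j then d else 0) /\
    signed_sum (fun i => if i == j then d else 0) = d.
  move=> d0; have [s1 e1] := nonneg_sum_single j d0.
  have [s0 e0] := nonneg_sum_single j (lexx (0 : R)).
  have [|? ->] := signed_sum_sub (a := fun i => if i == j then d else 0) s1 s0.
    by move=> i; case: ifP; rewrite subr0.
  by rewrite e1 e0 subr0.
have [|/ltW] := leP 0 c; first exact: pos.
rewrite -oppr_ge0 => /pos[sN NE]; have [] := signed_sumN sN; rewrite NE opprK.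
suff -> : (fun i => - (if i == j then - c else 0)) =
  (fun i => if i == j then c else 0) by [].
by apply/funext => i; case: ifP; rewrite ?oppr0 ?opprK.
Qed.

End esum_seq.

(** * The space [ell1]: pairing with bounded functions, truncation, completeness *)

Section ell1_theory.
Context {R : realType} (Gamma : choiceType).
Implicit Types (f h : ell1 R Gamma) (phi : Gamma -> R) (s : seq Gamma).

Lemma ell1_abs_summable f : abs_summable (f : Gamma -> R).
Proof. by split=> //; exact: ell1_summable f. Qed.

Lemma ell1_sum_le_norm f s : uniq s -> \sum_(i <- s) `|f i : R| <= `|f|.
Proof.
by move=> us; rewrite -lee_fin [leRHS]ell1_normK; exact: esum_ge_seq.
Qed.

Lemma ell1_norm_le_bound f (M : R) :
  (forall s, uniq s -> \sum_(i <- s) `|f i : R| <= M) -> `|f| <= M.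
Proof.
by move=> fM; rewrite -lee_fin [leLHS]ell1_normK; exact: esum_le_seq.
Qed.

Lemma is_ell1_bounded (a : Gamma -> R) (M : R) :
  (forall s, uniq s -> \sum_(i <- s) `|a i| <= M) ->
  (a : Gamma -> R^o) \in @is_ell1 R Gamma.
Proof.
move=> aM; apply/is_ell1P; apply: (@le_lt_trans _ _ M%:E); last exact: ltry.
exact: esum_le_seq.
Qed.

Lemma ell1_norm_approx f (e : R) : 0 < e ->
  exists2 s, uniq s & `|f| - e < \sum_(i <- s) `|f i : R|.
Proof.
move=> e0; apply: contrapT => nos.
have : `|f| <= `|f| - e.
  apply: ell1_norm_le_bound => s us; rewrite leNgt; apply/negP => ltf.
  by apply: nos; exists s.
by rewrite lerBDr; apply/negP; rewrite -ltNge ltrDl.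
Qed.

(** Not restricted to [c0]: the functions [i |-> iota i x] paired below are bounded but need not
    vanish at infinity. *)
Definition ell1_pairing f phi : R := signed_sum (fun i => phi i * f i).

Section bounded.
Variables (phi : Gamma -> R) (M : R).
Hypothesis phiM : forall i, `|phi i| <= M.

Lemma ell1_pairing_summable f : abs_summable (fun i => phi i * (f i : R)).
Proof.
have [sM _] := signed_sumZ M (ell1_abs_summable f).
apply: nonneg_summable_le sM => // i.
by rewrite normrM [leRHS]normrM ler_wpM2r// (le_trans (phiM i))// ler_norm.
Qed.

Lemma ell1_pairing_linear a f h :
  ell1_pairing (a *: f + h) phi = a * ell1_pairing f phi + ell1_pairing h phi.
Proof.
have sf := ell1_pairing_summable f; have sh := ell1_pairing_summable h.
have [sZ <-] := signed_sumZ a sf; have [_ <-] := signed_sumD sZ sh.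
congr signed_sum; apply/funext => i.
by rewrite -[(a *: f + h) i]/(a * f i + h i : R) mulrDr mulrCA.
Qed.

Lemma ell1_pairing_le f : `|ell1_pairing f phi| <= M * `|f|.
Proof.
(* Over an empty index type [M] may be negative, but then every norm is 0. *)
have [|i0] := pselect (exists i : Gamma, True); last first.
  have f0 : `|f| = 0.
    apply/eqP; rewrite eq_le normr_ge0 andbT; apply: ell1_norm_le_bound.
    by case=> [|i s _]; [rewrite big_nil|exfalso; apply: i0; exists i].
  rewrite f0 mulr0; apply: signed_sum_le; first exact: ell1_pairing_summable.
  apply: esum_le_seq => -[|i s _]; first by rewrite big_nil.
  by exfalso; apply: i0; exists i.
move=> [i _]; have M0 : 0 <= M by exact: le_trans (phiM i).
apply: signed_sum_le; first exact: ell1_pairing_summable.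
apply: esum_le_seq => s us.
apply: (@le_trans _ _ (\sum_(j <- s) M * `|f j : R|)).
  by apply: ler_sum => j _; rewrite normrM ler_wpM2r.
by rewrite -mulr_sumr ler_wpM2l// ell1_sum_le_norm.
Qed.

End bounded.

Definition single (i : Gamma) : Gamma -> R := fun j => if j == i then 1 else 0.

Lemma ell1_pairing_single f i : ell1_pairing f (single i) = f i.
Proof.
have [_ <-] := signed_sum_single i (f i : R); congr signed_sum.
apply/funext => j; rewrite /single.
by case: eqP => [->|]; rewrite ?mul1r ?mul0r.
Qed.

Lemma single_is_ell1 i : (single i : Gamma -> R^o) \in @is_ell1 R Gamma.
Proof. by apply/is_ell1P; case: (signed_sum_single i (1 : R)) => -[]. Qed.

Definition ell1_single i : ell1 R Gamma := Ell1 (single_is_ell1 i).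

Lemma ell1_pairing_ell1_single i phi : ell1_pairing (ell1_single i) phi = phi i.
Proof.
have [_ <-] := signed_sum_single i (phi i : R); congr signed_sum.
apply/funext => j; rewrite /= /single.
by case: eqP => [->|]; rewrite ?mulr1 ?mulr0.
Qed.

Lemma ell1_sum_apply f s (b : Gamma -> R) j :
  (\sum_(i <- s) b i *: ell1_single i) j = \sum_(i <- s) b i * single i j :> R.
Proof.
elim: s => [|i s IH]; first by rewrite !big_nil.
by rewrite !big_cons -IH.
Qed.

(** The difference vanishes on [s] and is [f] elsewhere, so any finite sum of its absolute values,
    joined to the sum over [s], is a finite sum for [f]. *)
Lemma ell1_truncate_norm f s : uniq s ->
  `|f - \sum_(i <- s) (f i : R) *: ell1_single i| <=
    `|f| - \sum_(i <- s) `|f i : R|.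
Proof.
move=> us; set g := \sum_(i <- s) _.
have gE j : g j = if j \in s then f j : R else 0.
  rewrite ell1_sum_apply// /single; case: ifP => js.
    rewrite (big_rem j)//= eqxx mulr1 big_seq big1 ?addr0// => i.
    by rewrite mem_rem_uniq// inE eq_sym => /andP[/negbTE -> _]; rewrite mulr0.
  rewrite big_seq big1// => i si; case: eqP => [ji|]; last by rewrite mulr0.
  by rewrite ji si in js.
apply: ell1_norm_le_bound => t ut; rewrite lerBrDl.
have -> : \sum_(i <- t) `|(f - g) i : R| =
    \sum_(i <- [seq i <- t | i \notin s]) `|f i : R|.
  rewrite big_filter [RHS]big_mkcond; apply: eq_bigr => i _.
  rewrite -[(f - g) i]/(f i - g i : R) gE.
  by case: ifP => _ /=; rewrite ?subr0 ?subrr ?normr0.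
rewrite -big_cat; apply: ell1_sum_le_norm.
rewrite cat_uniq us filter_uniq// andbT; apply/hasPn => i.
by rewrite mem_filter => /andP[].
Qed.

(** Approximations are indexed by their precision rather than by integers. Coordinatewise, the limit
    is the supremum of the lower estimates [A e i - e], each of which is at most every upper
    estimate [A d i + d]. *)
Lemma ell1_complete (A : R -> ell1 R Gamma) :
  (forall d e, 0 < d -> 0 < e -> `|A d - A e| <= d + e) ->
  exists f, forall d, 0 < d -> `|f - A d| <= d.
Proof.
move=> cauchyA.
have le_coord d e i : 0 < d -> 0 < e -> `|(A d i : R) - A e i| <= d + e.
  move=> d0 e0; have := cauchyA d e d0 e0; apply: le_trans.
  have := @ell1_sum_le_norm (A d - A e) [:: i] isT; rewrite big_seq1.
  by [].
pose L i : R := sup [set (A e i : R) - e | e in [set e | 0 < e]].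
have LA d i : 0 < d -> `|L i - A d i| <= d.
  move=> d0; have ub e : 0 < e -> (A e i : R) - e <= A d i + d.
    move=> e0; have := le_coord e d i e0 d0; rewrite ler_norml => /andP[_]; lra.
  have Ld : L i <= A d i + d.
    apply: ge_sup; first by exists ((A d i : R) - d), d.
    by move=> _ [e /= e0 <-]; exact: ub.
  have dL : (A d i : R) - d <= L i.
    apply: ub_le_sup; last by exists d.
    by exists (A d i + d) => _ [e /= e0 <-]; exact: ub.
  by rewrite ler_norml; lra.
have sumL d s : 0 < d -> uniq s -> \sum_(i <- s) `|L i - A d i| <= d.
  move=> d0 us; apply/ler_addgt0Pr => e e0.
  (* Each coordinate in [s] costs [r] when [L] is replaced by [A r], and [|A r - A d|] costs one
     further [r]. *)
  pose r := e / (1 + (size s)%:R).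
  have s0 : 0 < 1 + (size s)%:R :> R by rewrite ltr_wpDr// ltr01.
  have r0 : 0 < r by rewrite divr_gt0.
  have -> : d + e = r * (size s)%:R + (r + d).
    by rewrite /r; field; rewrite gt_eqF.
  apply: (@le_trans _ _ (\sum_(i <- s) (r + `|(A r - A d) i : R|))).
    apply: ler_sum => i _; rewrite -[(A r - A d) i]/(A r i - A d i : R).
    have -> : L i - A d i = (L i - A r i) + (A r i - A d i) :> R by ring.
    by rewrite (le_trans (ler_normD _ _))// lerD2r LA.
  rewrite big_split/= big_const_seq count_predT iter_addr addr0 -(mulr_natr r).
  rewrite lerD2l; apply: le_trans (cauchyA r d r0 d0).
  exact: (ell1_sum_le_norm (A r - A d) us).
have Lell1 : (L : Gamma -> R^o) \in @is_ell1 R Gamma.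
  apply: (@is_ell1_bounded _ (1 + `|A 1|)) => s us.
  apply: (@le_trans _ _ (\sum_(i <- s) (`|L i - A 1 i| + `|A 1 i : R|))).
    apply: ler_sum => i _; rewrite (le_trans _ (ler_normD _ _))//.
    by rewrite subrK.
  by rewrite big_split/= lerD ?sumL// ell1_sum_le_norm.
exists (Ell1 Lell1) => d d0; apply: ell1_norm_le_bound => s us.
exact: sumL.
Qed.

End ell1_theory.

(** * The isometry from [ell1] onto a dual with an [ell1] basis *)

Section ell1_synthesis.
Context {R : realType} (X : normedModType R) (Gamma : choiceType).
Variable iota : Gamma -> dual X.
Hypothesis iota_norm : forall s (b : Gamma -> R), uniq s ->
  `|\sum_(i <- s) b i *: iota i| = \sum_(i <- s) `|b i|.
(** Density of the span, phrased through all subspaces containing the family, so that the span is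
    never formed. It will be applied to the range of [synthesis]. *)
Hypothesis iota_dense : forall M : set (dual X), M 0 ->
  (forall a f g, M f -> M g -> M (a *: f + g)) -> (forall i, M (iota i)) ->
  forall (f : dual X) (e : R), 0 < e -> exists2 g, M g & `|f - g| < e.

Let iota_le x i : `|iota i x : R| <= `|x|.
Proof.
have := @iota_norm [:: i] (fun=> 1) isT.
rewrite !big_seq1 scale1r normr1 => i1.
by rewrite (le_trans (dual_apply_le _ _))// i1 mul1r.
Qed.

Let synthesis_bound (f : ell1 R Gamma) x :
  `|ell1_pairing f (fun i => iota i x)| <= `|f| * `|x|.
Proof. by rewrite mulrC; apply: ell1_pairing_le => i; exact: iota_le. Qed.

Let synthesis_linear (f : ell1 R Gamma) :
  linear (fun x => ell1_pairing f (fun i => iota i x) : R^o).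
Proof.
move=> a x y; have sx := ell1_pairing_summable (iota_le x) f.
have sy := ell1_pairing_summable (iota_le y) f.
have [sZ sZE] := signed_sumZ a sx; have [_ sDE] := signed_sumD sZ sy.
rewrite -[RHS]/(a * ell1_pairing f (fun i => iota i x) +
  ell1_pairing f (fun i => iota i y)) -sZE -sDE.
congr signed_sum; apply/funext => i.
have -> : iota i (a *: x + y) = a * iota i x + iota i y :> R by exact: linearP.
by rewrite mulrDl mulrA.
Qed.

Lemma synthesis_subproof (f : ell1 R Gamma) : exists F : dual X,
  forall x, F x = ell1_pairing f (fun i => iota i x).
Proof.
pose L := GRing.isLinear.Build R X R^o *:%R _ (synthesis_linear f).
pose h : {linear X -> R^o} :=
  HB.pack (fun x => ell1_pairing f (fun i => iota i x) : R^o) L.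
have [|x|F Fh _] := @dominated_dual _ _ h `|f|; first by [].
  exact: le_trans (ler_norm _) (synthesis_bound f x).
by exists F => x; rewrite Fh.
Qed.

Definition synthesis f : dual X := sval (cid (synthesis_subproof f)).

Lemma synthesisE f x : synthesis f x = ell1_pairing f (fun i => iota i x).
Proof. exact: (svalP (cid (synthesis_subproof f))). Qed.

Lemma synthesis_is_linear : linear synthesis.
Proof.
move=> a f h; apply: dualP => x.
rewrite -[RHS]/(a * synthesis f x + synthesis h x : R) !synthesisE.
exact: (ell1_pairing_linear (iota_le x)).
Qed.

HB.instance Definition _ := GRing.isLinear.Build R (ell1 R Gamma) (dual X) *:%R
  synthesis synthesis_is_linear.

Lemma synthesis_single i : synthesis (ell1_single i) = iota i.
Proof. by apply: dualP => x; rewrite synthesisE ell1_pairing_ell1_single. Qed.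

(** For the lower bound, [iota_norm] is exact on a finite truncation [g]. One [e / 2] pays for the
    mass that [g] loses, the other for [|f - g|]. *)
Lemma synthesis_norm f : `|synthesis f| = `|f|.
Proof.
have le_norm h : `|synthesis h| <= `|h|.
  apply: dual_norm_le_bound => // x; rewrite synthesisE.
  exact: le_trans (ler_norm _) (synthesis_bound h x).
apply/eqP; rewrite eq_le le_norm/=; apply/ler_addgt0Pr => e e0.
have e2 : 0 < e / 2 by rewrite divr_gt0.
have [s us fs] := ell1_norm_approx f e2.
set g := \sum_(i <- s) (f i : R) *: ell1_single i.
have gE : `|synthesis g| = \sum_(i <- s) `|f i : R|.
  rewrite linear_sum/= -iota_norm//; congr `|_|; apply: eq_bigr => i _.
  by rewrite linearZ/= synthesis_single.
have fg : `|synthesis g| <= `|synthesis f| + `|f - g|.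
  rewrite -[g in `|synthesis g|](subKr f) linearB/=.
  by rewrite (le_trans (ler_normB _ _))// lerD2l.
have := ell1_truncate_norm f us; rewrite -/g; lra.
Qed.

Lemma synthesis_surj F : exists f, synthesis f = F.
Proof.
(* The condition [0 < d] sits under the existential so that [choice] gives a function on all of [R].
   The approximants satisfy the Cauchy condition because [synthesis] is isometric. *)
have near d : exists f, 0 < d -> `|F - synthesis f| < d.
  have [d0|d0] := ltP 0 d; last by exists 0.
  have [||i|_ [f _ <-] ?] := iota_dense (M := range synthesis) _ _ _ F d0.
  - by exists 0 => //; rewrite linear0.
  - by move=> a _ _ [f _ <-] [g _ <-]; exists (a *: f + g); rewrite ?linearP.
  - by exists (ell1_single i) => //; exact: synthesis_single.
  - by exists f.
have [A FA] := choice near.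
have [d e d0 e0|f fA] := @ell1_complete _ _ A.
  rewrite -synthesis_norm linearB/= -(subrKA F) addrC.
  by rewrite (le_trans (ler_normD _ _))// addrC -normrN opprB lerD// ltW// FA.
exists f; apply/eqP; rewrite -subr_eq0 -normr_le0; apply/ler_addgt0Pr => e e0.
have e2 : 0 < e / 2 by rewrite divr_gt0.
rewrite add0r (splitr e) -(subrKA (synthesis (A (e / 2)))).
rewrite (le_trans (ler_normD _ _))// lerD//; last first.
  by rewrite -normrN opprB ltW// FA.
by rewrite -linearB/= synthesis_norm fA.
Qed.

Lemma ell1_analysis : exists T : {linear dual X -> ell1 R Gamma},
  isometric_isomorphism T.
Proof.
have [T TE] := choice synthesis_surj.
have synthesis_inj : injective synthesis.
  move=> f g fg; apply/eqP; rewrite -subr_eq0 -normr_eq0 -synthesis_norm.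
  by rewrite linearB/= fg subrr normr0.
have linT : linear T.
  by move=> a F G; apply: synthesis_inj; rewrite linearP/= !TE.
pose L := GRing.isLinear.Build R (dual X) (ell1 R Gamma) *:%R T linT.
pose T' : {linear dual X -> ell1 R Gamma} := HB.pack T L.
exists T'; split=> [F|f _]; first by rewrite -synthesis_norm TE.
by exists (synthesis f) => //; apply: synthesis_inj; rewrite TE.
Qed.

End ell1_synthesis.

Lemma hahn_banach_smooth_ell1 {R : realType} (X : normedModType R) :
  L1_predual X -> hahn_banach_smooth X ->
  exists (Gamma : choiceType) (T : {linear dual X -> ell1 R Gamma}),
    isometric_isomorphism T.
Proof.
move=> L1X hX.
(* one extreme point out of each pair [e], [- e] *)
pose rep (e : dual X) := choose (pred2 e (- e)) e.
pose P (e : dual X) := `[< extreme_point e >] && (rep e == e).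
pose Gamma : choiceType := {e : dual X | P e}.
(* [choose] depends on the pair only, not on which of its members is the starting point. *)
have repN e : rep (- e) = rep e.
  rewrite /rep (@choose_id _ (pred2 (- e) (- - e)) (- e) e); last 2 first.
  - by rewrite /= eqxx.
  - by rewrite /= opprK eqxx orbT.
  by apply: eq_choose => f; rewrite /= opprK orbC.
exists Gamma; apply: (@ell1_analysis _ _ _ (sval : Gamma -> dual X)).
  (* Coefficients are extended by 0 off [Gamma] to match a sum indexed by the dual itself. Two
     representatives cannot be opposite: they would coincide and be 0, against norm 1. *)
  move=> s b us; pose c e := if insub e is Some i then b i else 0.
  have cE i : c (sval i) = b i by rewrite /c valK.
  transitivity (`|\sum_(e <- map sval s) c e *: e|).
    by rewrite big_map; congr `|_|; apply: eq_bigr => i _; rewrite cE.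
  rewrite L1_predual_extreme_points//.
  - by rewrite big_map; apply: eq_bigr => i _; rewrite cE.
  - by rewrite map_inj_uniq//; exact: val_inj.
  - by move=> _ /mapP[i _ ->]; case/andP: (svalP i) => /asboolP.
  - move=> _ _ /mapP[i _ ->] /mapP[j _ ->] ij.
    case/andP: (svalP i) => /asboolP[i1 _] /eqP ri.
    case/andP: (svalP j) => _ /eqP rj.
    have : sval j = sval i by rewrite -rj ij repN ri.
    rewrite ij => /eqP; rewrite -subr_eq0 -opprD oppr_eq0 -mulr2n -scaler_nat.
    by rewrite scaler_eq0 pnatr_eq0/= -normr_eq0 i1 oner_eq0.
move=> M M0 MD Miota; apply: dense_span_extreme_points => // e ext_e.
have ext_rep : extreme_point (rep e).
  have : pred2 e (- e) (rep e) by apply: chooseP; rewrite /= eqxx.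
  by move=> /orP[]/eqP->//; exact: extreme_pointN.
have Prep : P (rep e).
  apply/andP; split; first exact/asboolP.
  have : pred2 e (- e) (rep e) by apply: chooseP; rewrite /= eqxx.
  by move=> /orP[]/eqP repE; rewrite repE ?repN repE.
have Mrep : M (rep e) := Miota (exist (fun f => P f) _ Prep).
have : pred2 e (- e) (rep e) by apply: chooseP; rewrite /= eqxx.
move=> /orP[]/eqP repE; first by rewrite -repE.
by rewrite -[e]opprK -repE -scaleN1r -[_ *: _]addr0; exact: MD.
Qed.

(** * Weak-star neighbourhoods on the dual sphere *)

Section pairing_topology_theory.
Context {R : realType} {V : choiceType} {I : Type} (B : V -> I -> R).

Lemma pairing_cvg (F : set_system V) (v : pairing_topology B) : Filter F ->
  (forall i, B ^~ i @ F --> B v i) -> F --> v.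
Proof.
move=> FF Fv A /=.
rewrite -[nbhs v A]/(nbhs (v : initial_topology (B : V -> prod_topology _)) A).
rewrite nbhsE => -[_ [[C oC <-] /= Cv] CA]; apply: filterS CA _.
suff : B @ F --> (B v : prod_topology (fun _ : I => R)).
  by apply; exact: open_nbhs_nbhs.
apply/cvg_sup => i U [W] [[D] oD <-] Dv DU; apply: (filterS DU).
by apply: (Fv i D); exact: open_nbhs_nbhs.
Qed.

Lemma pairing_continuous i : continuous (fun v : pairing_topology B => B v i).
Proof.
move=> v U Uv.
have /cvg_sup/(_ i) proj_cvg : nbhs (B v : prod_topology (fun _ : I => R)) -->
    (B v : prod_topology (fun _ : I => R)) by exact: cvg_id.
have init :=
  @initial_continuous _ _ (B : V -> prod_topology (fun _ : I => R)) v.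
suff H : nbhs (B v : prod_topology (fun _ : I => R)) [set f | U (f i)].
  exact: (init _ H).
apply: proj_cvg.
exact: (@initial_continuous _ _ (fun f : I -> R => f i) (B v) U Uv).
Qed.

(** A sum in place of a finite intersection describes a neighbourhood by one list and one radius;
    concatenation and [Num.min] intersect two of them. These sets generate a filter converging to
    [v] in each coordinate, hence finer than [nbhs v]. *)
Lemma pairing_nbhsP (v : pairing_topology B) (A : set V) : nbhs v A <->
  exists (s : seq I) (e : R), 0 < e /\
    forall w, \sum_(i <- s) `|B w i - B v i| < e -> A w.
Proof.
split=> [nA|[s [e [e0 sA]]]].
  pose b (p : seq I * R) :=
    [set w : V | \sum_(i <- p.1) `|B w i - B v i| < p.2].
  pose D := [set p : seq I * R | 0 < p.2].
  have FF : Filter (filter_from D b).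
    apply: filter_from_filter; first by exists ([::], 1); exact: ltr01.
    move=> [s d] [t e] /= d0 e0.
    exists (s ++ t, Num.min d e); first by rewrite /D/= lt_min d0.
    move=> w; rewrite /b/= big_cat/= lt_min => /andP[wd we].
    by split; [apply: le_lt_trans wd; rewrite lerDl|
               apply: le_lt_trans we; rewrite lerDr]; exact: sumr_ge0.
  have : filter_from D b --> v.
    apply: pairing_cvg => i; apply/cvgrPdist_lt => e e0.
    exists ([:: i], e) => // w; rewrite /b/= big_seq1.
    by rewrite distrC.
  by move=> /(_ _ nA) [[s e] /= e0 sA]; exists s, e; split=> // w; exact: sA.
have FF := @nbhs_filter (pairing_topology B) v.
(* Then [size s] terms of size at most [d] stay strictly below [e], also for empty [s]. *)
set d := e / (1 + (size s)%:R).
have d0 : 0 < d by rewrite divr_gt0// ltr_wpDr// ltr01.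
have near_d i : nbhs v [set w | `|B w i - B v i| < d].
  apply: (@pairing_continuous i v [set r | `|r - B v i| < d]).
  by apply/nbhs_ballP; exists d => // r; rewrite /ball/= distrC.
have near_sum t :
    nbhs v [set w | \sum_(i <- t) `|B w i - B v i| <= d * (size t)%:R].
  elim: t => [|i t IH].
    by apply: (@filterE _ _ FF) => w /=; rewrite big_nil mulr0.
  apply: (@filterS _ _ FF) (@filterI _ _ FF _ _ (near_d i) IH).
  move=> w [/ltW /= wi wt].
  by rewrite big_cons -natr1 mulrDr mulr1 addrC lerD.
apply: (@filterS _ _ FF) (near_sum s) => w /= /le_lt_trans wd; apply/sA/wd.
rewrite /d mulrAC ltr_pdivrMr; last by rewrite ltr_wpDr// ltr01.
by rewrite ltr_pM2l// ltrDr ltr01.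
Qed.

End pairing_topology_theory.

Section pairing_within.
Context {R : realType} {U V : choiceType} {I J : Type}.
Variables (B : U -> I -> R) (C : V -> J -> R) (A : set (pairing_topology B)).
Variable f : pairing_topology B -> pairing_topology C.

(** [weak_star], [weak] and [ell1_weak_star] are all pairing topologies, so this single criterion
    reduces every continuity claim of the theorem to estimates. *)
Lemma pairing_withinP :
  {within A, continuous f} <->
  forall v, A v -> forall j (e : R), 0 < e -> exists (s : seq I) (d : R),
    0 < d /\ forall w, A w -> \sum_(i <- s) `|B w i - B v i| < d ->
                         `|C (f w) j - C (f v) j| < e.
Proof.
split=> [|H].
  move=> /subspace_continuousP cf v Av j e e0.
  have [P /pairing_nbhsP[s [d [d0 sP]]] Pf] : exists2 P,
      nbhs (v : pairing_topology B) P &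
      forall w, P w -> A w -> `|C (f w) j - C (f v) j| < e.
    have nb : nbhs (f v : pairing_topology C)
        [set w | `|C w j - C (f v) j| < e].
      apply/pairing_nbhsP; exists [:: j], e; split=> // w.
      by rewrite big_seq1.
    have := cf v Av _ nb; rewrite /= nbhs_simpl => nA.
    by exists [set w | A w -> `|C (f w) j - C (f v) j| < e].
  by exists s, d; split=> // w Aw wd; apply: Pf => //; exact: sP.
apply/subspace_continuousP => v Av.
apply: (@pairing_cvg _ _ _ C) => j; apply/cvgrPdist_lt => e e0.
have [s [d [d0 sH]]] := H v Av j e e0.
rewrite /= nbhs_simpl.
suff : nbhs (v : pairing_topology B)
    [set w | A w -> `|C (f v) j - C (f w) j| < e] by [].
apply/pairing_nbhsP; exists s, d; split=> // w wd Aw.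
by rewrite distrC; exact: sH.
Qed.

Lemma pairing_within_seq v (t : seq J) (e : R) :
  {within A, continuous f} ->
  A v -> 0 < e -> exists (s : seq I) (d : R),
    0 < d /\ forall w, A w -> \sum_(i <- s) `|B w i - B v i| < d ->
                         \sum_(j <- t) `|C (f w) j - C (f v) j| < e.
Proof.
move=> /pairing_withinP cf Av; elim: t e => [|j t IH] e e0.
  by exists [::], 1; split=> // w _ _; rewrite big_nil.
have e2 : 0 < e / 2 by rewrite divr_gt0.
have [s [d [d0 sd]]] := cf v Av j _ e2; have [r [c [c0 rc]]] := IH _ e2.
exists (s ++ r), (Num.min d c); split=> [|w Aw]; first by rewrite lt_min d0.
rewrite big_cat/= lt_min big_cons => /andP[wd wc].
rewrite (splitr e) ltrD//; first apply: sd => //; last apply: rc => //.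
  by apply: le_lt_trans wd; rewrite lerDl sumr_ge0.
by apply: le_lt_trans wc; rewrite lerDr sumr_ge0.
Qed.

End pairing_within.

(* Helly: otherwise minimize [z |-> sum (u z - F u)^2] over the unit ball.  At a
   nearly optimal [z], [w = sum (F u - u z) u] nearly attains its norm, whereas
   [F w = w z + sum (F u - u z)^2]. *)
Lemma helly {R : realType} (Z : normedModType R) (F : dual (dual Z))
  (s : seq (dual Z)) (e : R) : `|F| <= 1 -> 0 < e ->
  exists2 z : Z, `|z| <= 1 & \sum_(u <- s) `|u z - F u : R| < e.
Proof.
move=> F1 e0.
pose q z : R := \sum_(u <- s) ((u z : R) - F u) ^+ 2.
pose Q := [set q z | z in [set z : Z | `|z| <= 1]].
have q0 z : 0 <= q z by apply: sumr_ge0 => u _; exact: sqr_ge0.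
have hQ : has_inf Q.
  split; first by exists (q 0), 0 => //=; rewrite normr0.
  by exists 0 => _ [z _ <-].
have le_q z : `|z| <= 1 -> inf Q <= q z.
  by move=> z1; apply: ge_inf; [case: hQ|exists z].
suff Q0 : inf Q <= 0.
  (* Passing from squares to absolute values by [|t| <= t^2 / (2 c) + c / 2]: a value of [q] below
     [c e] contributes less than [e / 2], and the constants [c / 2] add up to at most [e / 2]. *)
  pose c := e / (1 + (size s)%:R).
  have s0 : 0 < 1 + (size s)%:R :> R by rewrite ltr_wpDr// ltr01.
  have c0 : 0 < c by rewrite divr_gt0.
  have [_ [z /= z1 <-] qz] := inf_adherent (mulr_gt0 c0 e0) hQ.
  exists z => //.
  have le_t (t : R) : `|t| <= (2 * c)^-1 * t ^+ 2 + c / 2.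
    rewrite -real_normK ?num_real// -subr_ge0.
    have -> : (2 * c)^-1 * `|t| ^+ 2 + c / 2 - `|t| =
        (2 * c)^-1 * (`|t| - c) ^+ 2 by field; rewrite gt_eqF.
    by rewrite mulr_ge0 ?sqr_ge0// invr_ge0 mulr_ge0// ltW.
  apply: (@le_lt_trans _ _
    (\sum_(u <- s) ((2 * c)^-1 * ((u z : R) - F u) ^+ 2 + c / 2))).
    by apply: ler_sum => u _; exact: le_t.
  rewrite big_split/= -mulr_sumr -/(q z) big_const_seq count_predT.
  rewrite iter_addr addr0.
  have qz' : q z < c * e by apply: lt_le_trans qz _; rewrite gerDr.
  have -> : e = (2 * c)^-1 * (c * e) + e / 2 by field; rewrite gt_eqF.
  rewrite ltr_leD ?ltr_pM2l ?invr_gt0 ?mulr_gt0// -(mulr_natr (c / 2)).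
  rewrite mulrAC ler_pM2r ?invr_gt0// /c mulrAC ler_pdivrMr// ler_pM2l//.
  by rewrite lerDr.
rewrite leNgt; apply/negP; set m := inf Q => m0.
pose K : R := \sum_(u <- s) (2 * `|u|) ^+ 2.
have K0 : 0 <= K by apply: sumr_ge0 => u _; exact: sqr_ge0.
(* Step length for moving from [z] towards a point [h] of the ball. It is at most 1, so the move
   stays in the ball; [K] bounds the second-order coefficient, and [t * K <= m / 2] together with
   near-optimality up to [t * (m / 2)] leaves [w h - w z <= m / 2]. *)
pose t := m / (2 * (m + K)).
have mK : 0 < m + K by rewrite ltr_wpDr.
have t0 : 0 < t by rewrite divr_gt0// mulr_gt0.
have t1 : t <= 1.
  rewrite ler_pdivrMr ?mulr_gt0// mul1r; lra.
have tK : t * K <= m / 2.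
  rewrite /t mulrAC ler_pdivrMr ?mulr_gt0//.
  have -> : m / 2 * (2 * (m + K)) = m * (m + K) by field.
  by rewrite ler_pM2l// lerDr ltW.
have tm : 0 < t * (m / 2) by rewrite mulr_gt0// divr_gt0.
clearbody t.
have [_ [z /= z1 <-] qz] := inf_adherent tm hQ; rewrite -/m in qz.
(* Up to the factor -2, the gradient of [q] at [z]. *)
pose w : dual Z := \sum_(u <- s) ((F u : R) - u z) *: u.
have wE y : w y = \sum_(u <- s) ((F u : R) - u z) * u y :> R.
  rewrite /w; elim: (s) => [|u r IH]; first by rewrite !big_nil.
  by rewrite !big_cons -IH.
have Fw : F w = w z + q z :> R.
  rewrite wE /q -big_split/= linear_sum/=; apply: eq_bigr => u _.
  rewrite linearZ -[LHS]/(((F u : R) - u z) * F u) /=; ring.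
suff wm : `|w| <= w z + m / 2.
  have : F w <= `|w| :> R.
    rewrite (le_trans (ler_norm _))// (le_trans (dual_apply_le _ _))//.
    by rewrite ler_piMl.
  rewrite Fw; have := le_q z z1; rewrite -/m; lra.
apply: dual_norm_le => y y1.
have le_wy (h : Z) : `|h| <= 1 -> w h <= w z + m / 2 :> R.
  move=> h1; have zt1 : `|z + t *: (h - z)| <= 1.
    have -> : z + t *: (h - z) = (1 - t) *: z + t *: h.
      by rewrite scalerBr scalerBl scale1r addrCA addrC addrAC.
    have t1' : 0 <= 1 - t by rewrite subr_ge0.
    rewrite (le_trans (ler_normD _ _))// !normrZ.
    rewrite (ger0_norm t1') (ger0_norm (ltW t0)).
    have : (1 - t) * `|z| <= 1 - t by rewrite ler_piMr// subr_ge0.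
    have : t * `|h| <= t by rewrite ler_piMr// ltW.
    lra.
  have qt : q (z + t *: (h - z)) <=
      q z - 2 * t * ((w h : R) - w z) + t ^+ 2 * K.
    have -> : q z - 2 * t * ((w h : R) - w z) + t ^+ 2 * K =
        \sum_(u <- s) (((u z : R) - F u) ^+ 2 -
          2 * t * (((F u : R) - u z) * u h - ((F u : R) - u z) * u z) +
          t ^+ 2 * (2 * `|u|) ^+ 2).
      by rewrite big_split/= sumrB -!mulr_sumr sumrB -!wE.
    apply: ler_sum => u _.
    have -> : u (z + t *: (h - z)) = u z + t * (u h - u z) :> R.
      by rewrite linearD linearZ/= linearB.
    have uhz : ((u h : R) - u z) ^+ 2 <= (2 * `|u|) ^+ 2.
      rewrite -real_normK ?num_real// ler_pXn2r ?nnegrE ?mulr_ge0//.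
      rewrite (le_trans (ler_normB _ _))// mulr_natl mulr2n.
      by rewrite lerD// (le_trans (dual_apply_le _ _))// ler_piMr.
    have -> : ((u z : R) + t * (u h - u z) - F u) ^+ 2 =
        ((u z : R) - F u) ^+ 2 - 2 * t *
        (((F u : R) - u z) * u h - ((F u : R) - u z) * u z) +
        t ^+ 2 * ((u h : R) - u z) ^+ 2 by ring.
    by rewrite lerD2l ler_wpM2l// sqr_ge0.
  have := le_trans (le_q _ zt1) qt; rewrite -/m => mq.
  have : 0 <= 2 * (m / 2) - 2 * ((w h : R) - w z).
    rewrite -(pmulr_rge0 _ t0).
    have : t * (t * K) <= t * (m / 2) by rewrite ler_pM2l.
    rewrite expr2 in mq; lra.
  lra.
rewrite ler_norml le_wy// andbT lerNl -(linearN w).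
by apply: le_wy; rewrite normrN.
Qed.

Definition weak_star_weak_sphere {R : realType} (X : normedModType R) :=
  forall (f : dual X) (u : dual (dual X)) (e : R), `|f| = 1 -> 0 < e ->
  exists (s : seq X) (d : R), 0 < d /\ forall h : dual X, `|h| = 1 ->
    \sum_(x <- s) `|h x - f x : R| < d -> `|u h - u f : R| < e.

Lemma hahn_banach_smooth_weak_star_weak {R : realType} (X : normedModType R) :
  hahn_banach_smooth X -> weak_star_weak_sphere X.
Proof.
move=> hX f u e f1 e0; have e2 : 0 < e / 2 by rewrite divr_gt0.
have [x ux] := hahn_banach_smooth_approx hX u f1 e2.
have [y uy] := hahn_banach_smooth_approx hX (- u) f1 e2.
exists [:: x; y], (e / 2); split=> // h h1; rewrite !big_cons big_nil addr0.
(* With [u] and [x] this gives [u h < u f + e / 2 + (h x - f x)]; with [- u] and [y] it gives the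
   matching lower estimate. *)
have bound (v : dual (dual X)) z :
    (v h : R) <= `|v - canonical_embedding z| + h z.
  rewrite -lerBlDr; have := dual_apply_le (v - canonical_embedding z) h.
  by rewrite h1 mulr1 => /(le_trans (ler_norm _)).
have := bound u x; have := bound (- u) y.
rewrite dual_applyN; rewrite dual_applyN in uy.
rewrite ltr_norml => uyh uxh hs.
have := ler_norm ((h x : R) - f x); have := ler_norm ((h y : R) - f y).
have := normr_ge0 ((h x : R) - f x); have := normr_ge0 ((h y : R) - f y).
by move=> ? ? ? ?; apply/andP; split; lra.
Qed.

(** Helly's theorem replaces an extension [F] by some [g] in the dual ball that agrees with [F]
    approximately at [u], at the points of a weak-star neighbourhood of [f], and at a point nearly
    norming [f]. The last makes [|g|] close to 1, so [g] can be normalized to [h] inside that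
    neighbourhood; then [F u], [u g], [u h] and [u f] are all close. *)
Lemma weak_star_weak_hahn_banach_smooth {R : realType} (X : normedModType R) :
  weak_star_weak_sphere X -> hahn_banach_smooth X.
Proof.
move=> hX.
have unit_case (f : dual X) (F : dual (dual (dual X))) : `|f| = 1 ->
    `|F| = 1 -> (forall x, F (canonical_embedding x) = f x) ->
    forall u, F u = u f.
  move=> f1 F1 Ff u; apply/eqP; rewrite -subr_eq0 -normr_le0.
  apply/ler_addgt0Pr => e e0; rewrite add0r.
  have e2 : 0 < e / 2 by rewrite divr_gt0.
  have [s [d [d0 sd]]] := hX f u _ f1 e2.
  pose S : R := \sum_(x <- s) `|x|.
  have S0 : 0 <= S by exact: sumr_ge0.
  have S1 : 0 < 1 + 2 * S by rewrite ltr_wpDr// mulr_ge0.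
  have u1 : 0 < 1 + 2 * `|u| by rewrite ltr_wpDr// mulr_ge0.
  (* Normalizing moves [g] by at most [2 n]. The bound 1/4 keeps [g] away from 0; the other two
     absorb the error [n] from Helly and the displacement, on the points of [s] and at [u]
     respectively. *)
  pose n := Num.min 4^-1 (Num.min (d / (1 + 2 * S)) (e / 2 / (1 + 2 * `|u|))).
  have n0 : 0 < n by rewrite !lt_min invr_gt0 ltr0n /= !divr_gt0.
  have n4 : n <= 4^-1 by rewrite ge_min lexx.
  have nS : n * (1 + 2 * S) <= d.
    by rewrite -ler_pdivlMr// /n !ge_min lexx orbT.
  have nu : n * (1 + 2 * `|u|) <= e / 2.
    by rewrite -ler_pdivlMr// /n !ge_min lexx !orbT.
  have [x0 x01 fx0] : exists2 x : X, `|x| <= 1 & 1 - n < f x.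
    apply: contrapT => nox; have : `|f| <= 1 - n.
      apply: dual_norm_le => x x1; rewrite ler_norml; apply/andP; split.
        rewrite lerNl -(linearN f) leNgt; apply/negP => fx.
        by apply: nox; exists (- x); rewrite ?normrN.
      by rewrite leNgt; apply/negP => fx; apply: nox; exists x.
    rewrite f1; lra.
  have F1' : `|F| <= 1 by rewrite F1.
  have [g g1 gn] := helly
    (u :: canonical_embedding x0 :: map canonical_embedding s) F1' n0.
  rewrite !big_cons big_map Ff in gn.
  rewrite (eq_bigr (fun x => `|g x - f x : R|)) in gn; last first.
    by move=> x _; rewrite Ff.
  set a := `|_ - F u| in gn; set b := `|_ - f x0 : R| in gn.
  set c := \sum_(x <- s) _ in gn.
  have a0 : 0 <= a by exact: normr_ge0.
  have b0 : 0 <= b by exact: normr_ge0.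
  have c0 : 0 <= c by exact: sumr_ge0.
  have gx0 : 1 - 2 * n < `|g|.
    have : g x0 <= `|g| :> R.
      rewrite (le_trans (ler_norm _))// (le_trans (dual_apply_le _ _))//.
      by rewrite ler_piMr.
    have : `|(g x0 : R) - f x0| < n by rewrite -[X in X < _]/b; lra.
    rewrite ltr_norml => /andP[+ _]; lra.
  have g0 : 0 < `|g| by lra.
  pose h := `|g|^-1 *: g.
  have h1 : `|h| = 1 by rewrite normrZ normfV normr_id mulVf// gt_eqF.
  have hg : `|h - g| <= 2 * n.
    have -> : h - g = (1 - `|g|) *: h.
      by rewrite scalerBl scale1r /h scalerA mulfV ?gt_eqF// scale1r.
    rewrite normrZ h1 mulr1 ger0_norm ?subr_ge0//; lra.
  have hs : \sum_(x <- s) `|h x - f x : R| < d.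
    apply: (@le_lt_trans _ _ (\sum_(x <- s) (2 * n * `|x| + `|g x - f x : R|))).
      apply: ler_sum => x _.
      have -> : h x - f x = (h - g) x + (g x - f x) :> R.
        by rewrite dual_applyB addrA subrK.
      rewrite (le_trans (ler_normD _ _))// lerD2r.
      by rewrite (le_trans (dual_apply_le _ _))// ler_wpM2r.
    rewrite big_split/= -mulr_sumr -/S -/c.
    apply: lt_le_trans nS.
    rewrite mulrDr mulr1 mulrA (mulrC n) addrC ltrD2r; lra.
  have := sd h h1 hs.
  have -> : F u - u f = (u h - u f) - u (h - g) - ((u g : R) - F u).
    by rewrite linearB/= -[u h - u g]/((u h : R) - u g); ring.
  move=> uhf; rewrite (le_trans (ler_normB _ _))//.
  have uhg : `|u (h - g) : R| <= `|u| * (2 * n).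
    by rewrite (le_trans (dual_apply_le _ _))// ler_wpM2l.
  have := ler_normB ((u h : R) - u f) (u (h - g)).
  rewrite -[`|_ - F u|]/a; lra.
move=> f; exists (canonical_embedding f); split.
  by split=> //; exact: canonical_embedding_dual_norm.
move=> F [Ff normF]; apply: dualP => u.
(* The zero functional cannot be normalized, but its extension has norm 0. *)
have [f0|f0] := eqVneq f 0.
  move: normF; rewrite f0 normr0 => /normr0_eq0 ->.
  by rewrite /= linear0.
have fn0 : `|f| != 0 by rewrite normr_eq0.
have fK : `|f| *: (`|f|^-1 *: F) = F by rewrite scalerA mulfV// scale1r.
have := unit_case (`|f|^-1 *: f) (`|f|^-1 *: F).
rewrite !normrZ normF normfV normr_id mulVf// => /(_ erefl erefl) H.
have /H/(_ u) : forall x, (`|f|^-1 *: F) (canonical_embedding x) =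
    (`|f|^-1 *: f) x.
  by move=> x; rewrite -[LHS]/(`|f|^-1 *: F (canonical_embedding x)) Ff.
rewrite linearZ => /(congr1 (fun r : R^o => `|f| *: r)).
rewrite -[X in X = _]/((`|f| *: (`|f|^-1 *: F)) u) fK => ->.
by rewrite /= scalerA mulfV// scale1r.
Qed.

Section isometric_isomorphism.
Context {R : realType} (U V : normedModType R) (T : {linear U -> V}).
Hypothesis isoT : isometric_isomorphism T.

Lemma isometric_inverse : exists S : {linear V -> U},
  [/\ cancel T S, cancel S T & forall v, `|S v| = `|v|].
Proof.
have [Tnorm Tsurj] := isoT.
have Tinj : injective T.
  move=> x y xy; apply/eqP; rewrite -subr_eq0 -normr_eq0 -Tnorm.
  by rewrite linearB xy subrr normr0.
have exT v : exists u, T u = v by have [u _ <-] := Tsurj v I; exists u.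
have [S TS] := choice exT.
have linS : linear S by move=> a v w; apply: Tinj; rewrite linearP !TS.
pose L := GRing.isLinear.Build R V U *:%R S linS.
pose S' : {linear V -> U} := HB.pack S L.
exists S'; split=> [u|v|v] //=; first by apply: Tinj; rewrite TS.
by rewrite -Tnorm TS.
Qed.

Lemma isometric_isomorphism_sphere : set_bij (unit_sphere U) (unit_sphere V) T.
Proof.
have [S [TS ST Snorm]] := isometric_inverse; have [Tnorm _] := isoT.
split=> [x /= x1|x y _ _ /(congr1 S)|v /= v1].
- by rewrite /unit_sphere/= Tnorm.
- by rewrite !TS.
- by exists (S v); rewrite /unit_sphere/= ?Snorm.
Qed.

End isometric_isomorphism.

Lemma dual_comp {R : realType} (U V : normedModType R) (T : {linear U -> V})
  (f : dual V) : (forall x, `|T x| <= `|x|) ->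
  exists g : dual U, forall x, g x = f (T x).
Proof.
move=> T1; have [||g gE _] := @dominated_dual _ _ (f \o T) `|f|.
- by [].
- move=> x; rewrite (le_trans (ler_norm _))// (le_trans (dual_apply_le _ _))//.
  by rewrite ler_wpM2l.
by exists g.
Qed.

Section ell1_sphere.
Context {R : realType} (Gamma : choiceType).

(** Makes the weak topology of [ell1] at least as fine as its weak-star topology. *)
Lemma ell1_c0_dual (phi : c0 R Gamma) : exists u : dual (ell1 R Gamma),
  forall f, u f = ell1_c0_pairing f phi.
Proof.
have [M phiM] := c0_bounded (set_valP phi).
pose p (f : ell1 R Gamma) : R^o := ell1_c0_pairing f phi.
have linp : linear p by move=> a f h; exact: (ell1_pairing_linear phiM).
pose L := GRing.isLinear.Build R (ell1 R Gamma) R^o *:%R p linp.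
pose h : {linear ell1 R Gamma -> R^o} := HB.pack p L.
have [||u uh _] := @dominated_dual _ _ h `|M|; first by [].
  move=> f; rewrite (le_trans (ler_norm _))//.
  rewrite (le_trans (ell1_pairing_le phiM f))//.
  by rewrite ler_wpM2r// ler_norm.
by exists u.
Qed.

Lemma single_c0 (i : Gamma) : c0 R Gamma (@single R Gamma i).
Proof.
move=> e e0; apply: (@sub_finite_set _ _ [set i]); last exact: finite_set1.
move=> j; rewrite /= /single; case: eqP => // _.
by rewrite normr0 ltNge ltW.
Qed.

Definition c0_single (i : Gamma) : c0 R Gamma :=
  exist (fun phi => phi \in c0 R Gamma) _ (mem_set (@single_c0 i)).

Lemma ell1_c0_pairing_single (f : ell1 R Gamma) i :
  ell1_c0_pairing f (c0_single i) = f i.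
Proof. exact: ell1_pairing_single. Qed.

Lemma ell1_single_norm_le (i : Gamma) : `|ell1_single i : ell1 R Gamma| <= 1.
Proof.
apply: ell1_norm_le_bound => s us.
have -> : \sum_(j <- s) `|(ell1_single i : ell1 R Gamma) j : R| =
    \sum_(j <- s | j == i) 1.
  rewrite [RHS]big_mkcond; apply: eq_bigr => j _; rewrite /= /single.
  by case: ifP; rewrite ?normr1 ?normr0.
rewrite big_const_seq iter_addr addr0 -[count _ _]/(count_mem i s).
by rewrite count_uniq_mem//; case: (i \in s); rewrite ?mulr0n ?mulr1n.
Qed.

(* On the sphere, coordinates close to those of [f] on a finite set carrying
   almost all of the mass of [f] leave little mass elsewhere. *)
Lemma ell1_weak_star_sphere (f : ell1 R Gamma) (e : R) : `|f| = 1 -> 0 < e ->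
  exists (t : seq (c0 R Gamma)) (d : R), 0 < d /\
    forall h : ell1 R Gamma, `|h| = 1 ->
    \sum_(phi <- t) `|ell1_c0_pairing h phi - ell1_c0_pairing f phi| < d ->
    `|h - f| < e.
Proof.
move=> f1 e0; have e4 : 0 < e / 4 by rewrite divr_gt0.
have [s us fs] := ell1_norm_approx f e4.
(* Of the four quarters, the tail of [f] and the difference on [s] take one each. The tail of [h]
   takes two: it is at most the mass of [f] outside [s] plus the difference on [s], both norms being
   1. *)
exists (map c0_single s), (e / 4); split=> // h h1.
rewrite big_map; under eq_bigr do rewrite !ell1_c0_pairing_single.
move=> hf; have := ell1_truncate_norm f us; have := ell1_truncate_norm h us.
set hs := \sum_(i <- s) (h i : R) *: _; set fs' := \sum_(i <- s) (f i : R) *: _.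
rewrite f1 h1 in fs *.
have hfs : `|hs - fs'| <= \sum_(i <- s) `|h i - f i : R|.
  rewrite -sumrB (le_trans (ler_norm_sum _ _ _))//; apply: ler_sum => i _.
  by rewrite -scalerBl normrZ ler_piMr// ell1_single_norm_le.
have sums : \sum_(i <- s) `|f i : R| <=
    \sum_(i <- s) `|h i : R| + \sum_(i <- s) `|h i - f i : R|.
  rewrite -big_split/=; apply: ler_sum => i _.
  rewrite -lerBlDl -[leRHS]normrN opprB; exact: lerB_dist.
have -> : h - f = (h - hs) + (hs - fs') - (f - fs').
  by rewrite subrKA opprB addrA subrK.
have := ler_normB ((h - hs) + (hs - fs')) (f - fs').
have := ler_normD (h - hs) (hs - fs').
lra.
Qed.

(** Weak-star closeness on the sphere is norm closeness, which every continuous functional respects;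
    [1 + |u|] allows for [u = 0]. *)
Lemma dual_continuous_sphere (u : dual (ell1 R Gamma)) (f : ell1 R Gamma)
    (e : R) : `|f| = 1 -> 0 < e ->
  exists (t : seq (c0 R Gamma)) (d : R), 0 < d /\
    forall h : ell1 R Gamma, `|h| = 1 ->
    \sum_(phi <- t) `|ell1_c0_pairing h phi - ell1_c0_pairing f phi| < d ->
    `|u h - u f : R| < e.
Proof.
move=> f1 e0; have u0 : 0 < 1 + `|u| by rewrite ltr_wpDr// ltr01.
have [t [d [d0 td]]] := ell1_weak_star_sphere f1 (divr_gt0 e0 u0).
exists t, d; split=> // h h1 /(td h h1); rewrite ltr_pdivlMr// => hf.
rewrite -(linearB u) (le_lt_trans (dual_apply_le _ _))//.
by apply: le_lt_trans hf; rewrite mulrC ler_wpM2l// lerDr.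
Qed.

End ell1_sphere.

Theorem theorem3p5 (R : realType) (X : completeNormedModType R)
    (hX : L1_predual X) :
  [<-> hahn_banach_smooth X;
       exists (Gamma : choiceType) (T : {linear dual X -> ell1 R Gamma}),
         isometric_isomorphism T /\
         homeomorphism_on (weak_star X) (ell1_weak_star R Gamma)
           (unit_sphere (dual X)) (unit_sphere (ell1 R Gamma)) T;
       exists (Gamma : choiceType) (T : {linear dual X -> ell1 R Gamma}),
         isometric_isomorphism T /\
         homeomorphism_on (weak_star X) (weak (ell1 R Gamma))
           (unit_sphere (dual X)) (unit_sphere (ell1 R Gamma)) T].
Proof.
split; last split.
- move=> hbs; have [Gamma [T isoT]] := hahn_banach_smooth_ell1 hX hbs.
  exists Gamma, T; split=> //.
  have [S [TS ST Snorm]] := isometric_inverse isoT; have [Tnorm _] := isoT.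
  split; first exact: isometric_isomorphism_sphere.
    (* Composed with [T], the functional given by [phi] lies in the bidual, where smoothness
       compares weak with weak-star. *)
    apply/pairing_withinP => f f1 phi e e0.
    have [v vE] := ell1_c0_dual phi.
    have [|u uE] := dual_comp (T := T) v; first by move=> g; rewrite Tnorm.
    have [s [d [d0 sd]]] :=
      hahn_banach_smooth_weak_star_weak hbs u f1 e0.
    exists s, d; split=> // h h1 hs; rewrite -!vE -!uE; exact: sd.
  exists S; first by move=> f _; exact: TS.
  (* Evaluation at [x], composed with [S], is a continuous functional on [ell1], hence weak-star
     continuous on its sphere. *)
  apply/pairing_withinP => f f1 x e e0.
  have [|u uE] := dual_comp (T := S) (canonical_embedding x).
    by move=> g; rewrite Snorm.
  have [t [d [d0 td]]] := dual_continuous_sphere u f1 e0.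
  by exists t, d; split=> // h h1 /(td h h1); rewrite !uE.
- move=> [Gamma [T [isoT [Tbij Tcont [S TS Scont]]]]].
  exists Gamma, T; split=> //; split=> //.
    apply/pairing_withinP => f f1 u e e0.
    have Tf1 : `|T f| = 1 by rewrite (proj1 isoT).
    have [t [d [d0 td]]] := dual_continuous_sphere u Tf1 e0.
    have [s [c [c0 sc]]] := pairing_within_seq t Tcont f1 d0.
    exists s, c; split=> // h h1 /(sc h h1); apply: td.
    by rewrite (proj1 isoT).
  exists S => //; apply/pairing_withinP => f f1 x e e0.
  have /pairing_withinP/(_ f f1 x e e0)[t [d [d0 td]]] := Scont.
  have [D DE] := choice (@ell1_c0_dual R Gamma).
  exists (map D t), d; split=> // h h1; rewrite big_map => hD; apply: td => //.
  by under eq_bigr do rewrite -!DE.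
- move=> [Gamma [T [isoT [Tbij Tcont _]]]].
  have [S [TS ST Snorm]] := isometric_inverse isoT.
  apply: weak_star_weak_hahn_banach_smooth => f u e f1 e0.
  (* Since [u = v \o T], the weak continuity of [T] tested at [v] is exactly the required estimate
     for [u]. *)
  have [|v vE] := dual_comp (T := S) u; first by move=> g; rewrite Snorm.
  have /pairing_withinP/(_ f f1 v e e0)[s [d [d0 sd]]] := Tcont.
  by exists s, d; split=> // h h1 /(sd h h1); rewrite !vE !TS.
Qed.
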